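(* Let $X$ be a Hilbert space with orthonormal basis $\{\phi_i:i\in\mathbb{N}\}$, $H$ a Hilbert space, $K\colon X\to H$ linear and bounded, $1\le q<2$, and $J(u)=\sum_i|\langle\phi_i,u\rangle|^q\in[0,\infty]$. Let $g\in H$ and let $u^\dagger$ be a solution of $\inf_{u\in X}J(u)$ subject to $Ku=g$. Assume that there exist $0<\nu\le 1/2$ and $p^\dagger\in X$ such that $$(K^*K)^\nu p^\dagger=\xi^\dagger\in\partial J(u^\dagger),$$ and that $\operatorname{supp}(u^\dagger):=\{i\in\mathbb{N}:\langle\phi_i,u^\dagger\rangle\ne0\}$ is finite. If $q>1$, assume in addition that the restriction of $K$ to $\operatorname{span}\{\phi_i:i\in\operatorname{supp}(u^\dagger)\}$ is injective; if $q=1$, assume in addition that the restriction of $K$ to $\operatorname{span}\{\phi_i:|\langle\phi_i,\xi^\dagger\rangle|=1\}$ is injective. Then: (a) There exist a constant $C>0$ and an index function $\Phi$ with $\Phi(s)\asymp s^{\frac{q\nu}{q-1+2\nu}}$ as $s\to0$ (for $q=1$ this means $\Phi(s)\asymp s^{1/2}$, independently of $\nu$) such that $$C\|u^\dagger-u\|^q\le J(u)-J(u^\dagger)+\Phi(\|Ku-g\|^2)\qquad\text{for all }u\in X.$$ The Legendre-Fenchel conjugate $\Psi$ of $\Phi^{-1}$ satisfies $\Psi(s)\asymp s^{\frac{q-1+2\nu}{q-1+(2-q)\nu}}$ as $s\to0$. (b) For $\delta>0$ and $g^\delta\in H$ with $\|g-g^\delta\|\le\delta$, let $\{u_n^\delta\}_{n\ge1}$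 be generated by the augmented Lagrangian method described in the context. If $n=n(\delta)$ is chosen such that $t_n\asymp\delta^{-2\frac{q-1+(2-q)\nu}{q-1+2\nu}}$, then there is a constant $C>0$ independent of $\delta$ such that $$\|u_n^\delta-u^\dagger\|\le C\,\delta^{\frac{2\nu}{q-1+2\nu}}$$ for $\delta>0$ sufficiently small. (c) A similar estimate holds for Morozov's discrepancy principle: if the step sizes $\{\tau_k\}_{k\in\mathbb{N}}$ are bounded, $\rho>1$, and the iteration is stopped at $$n^*(\delta)=\min\{n\in\mathbb{N}:\|Ku_n^\delta-g^\delta\|\le\rho\delta\},$$ then there is a constant $C>0$ independent of $\delta$ (but possibly depending on $\rho$ and $\sup_k\tau_k$) such that $$\|u_{n^*(\delta)}^\delta-u^\dagger\|\le C\,\delta^{\frac{2\nu}{q-1+2\nu}}$$ for $\delta>0$ sufficiently small.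
   Context: A solution of $\inf_{u\in X}J(u)$ subject to $Ku=g$ is $u^\dagger\in X$ with $Ku^\dagger=g$, $J(u^\dagger)<\infty$ and $J(u^\dagger)\le J(u)$ for all $u$ with $Ku=g$. $\partial J(u^\dagger)$ denotes the convex subdifferential of $J$ at $u^\dagger$ (with $X^*$ identified with $X$), and $K^*$ is the adjoint of $K$. An index function is a continuous, strictly increasing and concave function $\Phi\colon[0,\infty)\to[0,\infty)$ with $\Phi(0)=0$. The Legendre-Fenchel conjugate of $\Phi^{-1}$ is $\Psi(s)=\sup_{t\ge0}[st-\Phi^{-1}(t)]$. The notation $a\asymp b$ means that the quotient $a/b$ is bounded above and below by positive constants (independent of $\delta$, respectively of $s$ near $0$). Augmented Lagrangian method (ALM): given $g^\delta\in H$, an initial value $p_0^\delta\in H$ and positive parameters (step sizes) $\{\tau_k\}_{k\in\mathbb{N}}$ with $t_n:=\sum_{k=1}^n\tau_k\to\infty$, compute for $k=1,2,\dots$ $$u_k^\delta\in\operatorname{argmin}_{u\in X}\Bigl[\frac{\tau_k}{2}\|Ku-g^\delta\|^2+J(u)-\langle p_{k-1}^\delta,Ku-g^\delta\rangle\Bigr],\qquad p_k^\delta=p_{k-1}^\delta+\tau_k(g^\delta-Ku_k^\delta).$$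
   Formalization: In (b) and (c) the initial values p_0^δ are assumed bounded, ‖p_0^δ‖ ≤ B with B independent of δ, and C may depend on B; for initial values unbounded as δ→0 the stated rates fail. *)

(* Defs.v *)
From HB Require Import structures.
From mathcomp Require Import all_boot all_order all_algebra.
From mathcomp Require Import all_classical all_reals all_analysis.

Set Implicit Arguments.
Unset Strict Implicit.
Unset Printing Implicit Defensive.

Import Order.TTheory GRing.Theory Num.Theory.
Import numFieldNormedType.Exports.

Local Open Scope classical_set_scope.
Local Open Scope ring_scope.

(* A real Hilbert space is a complete normed space [X] together with
   [dot : {dot X for idfun}] (bilinear, symmetric, positive definite) such that
   [norm_of_dot dot] holds. *)

Section hilbert.
Context {R : realType} {X : completeNormedModType R}.
Implicit Types dot : {dot X for idfun}.

Definition norm_of_dot dot := forall x : X, `|x| ^+ 2 = dot x x.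

Definition lspan (phi : nat -> X) (S : set nat) : set X :=
  [set x | exists (s : seq nat) (a : nat -> R),
      (forall i, i \in s -> S i) /\ x = \sum_(i <- s) a i *: phi i].

Definition orthonormal_basis dot (phi : nat -> X) :=
  (forall i j, dot (phi i) (phi j) = (i == j)%:R) /\ dense (lspan phi setT).

(* Convex subdifferential, with the dual space identified with [X]. *)
Definition subdifferential dot (J : X -> \bar R) (u : X) : set X :=
  [set xi | (J u < +oo)%E /\
            forall v, (J u + (dot xi (v - u))%:E <= J v)%E].

Definition supp dot (phi : nat -> X) (u : X) : set nat :=
  [set i | dot (phi i) u != 0].

Definition lq_penalty dot (phi : nat -> X) (q : R) (u : X) : \bar R :=
  (\sum_(0 <= i <oo) (`|dot (phi i) u| `^ q)%:E)%E.

Definition opnorm (A : X -> X) : R := sup [set `|A x| | x in [set x | `|x| <= 1]].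

Definition poly_op (P : {poly R}) (A : X -> X) (x : X) : X :=
  \sum_(i < size P) P`_i *: iter i A x.

(* Continuous functional calculus for a bounded, self-adjoint, nonnegative [A],
   whose spectrum lies in [0, opnorm A]: [f(A) x] is the common limit of
   [P_n(A) x] over all sequences of polynomials [P_n] converging to [f]
   uniformly on that interval. *)
Definition cfc (A : X -> X) (f : R -> R) (x : X) : X :=
  xget 0 [set y | forall P : nat -> {poly R},
    {uniform `[0, opnorm A], (fun n => horner (P n) : R -> R) @ \oo --> f} ->
    poly_op (P n) A x @[n --> \oo] --> y].

Definition op_powR (A : X -> X) (nu : R) : X -> X := cfc A (fun t => t `^ nu).

Definition argmin (F : X -> \bar R) : set X :=
  [set u | forall v, (F u <= F v)%E].

End hilbert.

Section operators.
Context {R : realType} {X H : completeNormedModType R}.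
Variables (dotX : {dot X for idfun}) (dotH : {dot H for idfun}) (K : X -> H).

Definition adjoint (y : H) : X :=
  xget 0 [set x | forall u, dotH (K u) y = dotX u x].

Definition constrained_solution (J : X -> \bar R) (g : H) : set X :=
  [set u | [/\ K u = g, (J u < +oo)%E &
               forall v, K v = g -> (J u <= J v)%E]].

Definition alm_objective (J : X -> \bar R) (tau : R) (p gd : H) (u : X) : \bar R :=
  ((tau / 2 * `|K u - gd| ^+ 2)%:E + J u - (dotH p (K u - gd))%:E)%E.

(* The primal iterates are [u 1, u 2, ...] and the step sizes
   [tau 1, tau 2, ...]; [u 0] and [tau 0] are irrelevant. *)
Definition alm_iterates (J : X -> \bar R) (tau : nat -> R) (gd p0 : H)
    (u : nat -> X) (p : nat -> H) :=
  p 0%N = p0 /\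
  forall k, argmin (alm_objective J (tau k.+1) (p k) gd) (u k.+1) /\
            p k.+1 = p k + tau k.+1 *: (gd - K (u k.+1)).

Definition discrepancy_index (rho delta : R) (gd : H) (u : nat -> X) (n : nat) :=
  [/\ (1 <= n)%N, `|K (u n) - gd| <= rho * delta &
      forall m, (1 <= m)%N -> `|K (u m) - gd| <= rho * delta -> (n <= m)%N].

End operators.

Section scalar.
Context {R : realType}.

Definition stepsum (tau : nat -> R) (n : nat) : R := \sum_(1 <= k < n.+1) tau k.

Definition step_sizes (tau : nat -> R) :=
  (forall k, (1 <= k)%N -> 0 < tau k) /\ stepsum tau n @[n --> \oo] --> +oo.

Definition asymp0 (a : R -> \bar R) (b : R -> R) :=
  exists c1 c2 : R, [/\ 0 < c1, 0 < c2 &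
    \forall s \near 0^'+, ((c1 * b s)%:E <= a s <= (c2 * b s)%:E)%E].

(* Only the values on [0, +oo) matter; they are nonnegative by monotonicity. *)
Definition index_function (Phi : R -> R) :=
  [/\ {within `[0, +oo[, continuous Phi},
      {in `[0, +oo[ &, {homo Phi : s t / s < t}},
      convex_function (E := R^o) `[0, +oo[ (\- Phi) &
      Phi 0 = 0].

(* The inverse takes the value [+oo] outside the range of [Phi] (an index
   function may be bounded). *)
Definition index_inv (Phi : R -> R) (t : R) : \bar R :=
  ereal_inf [set r%:E | r in [set r | 0 <= r /\ Phi r = t]].

Definition conjugate_inv (Phi : R -> R) (s : R) : \bar R :=
  ereal_sup [set ((s * t)%:E - index_inv Phi t)%E | t in [set t | 0 <= t]].

End scalar.

(* Main.v *)
Require Import Defs.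
From HB Require Import structures.
From mathcomp Require Import all_boot all_order all_algebra.
From mathcomp Require Import all_classical all_reals all_analysis.
From mathcomp Require Import ring lra zify.
Import Order.TTheory GRing.Theory Num.Theory.
Import numFieldNormedType.Exports.
Local Open Scope classical_set_scope.
Local Open Scope ring_scope.

(* Variational inequality.  With xi = xidag, positivity of the Bernstein basis
   polynomials of K^*K, followed by Jensen, gives
   <xi, w> <= C |K w|^(2 nu) |w|^(1 - 2 nu), while xi being a subgradient at udag
   forces J v - <xi, v> >= c |v|^q for all v with zero coordinates on a finite
   index set I that contains the support of udag and on whose span K is
   injective.  Splitting u along I and applying Young's inequality yields the inequality with
   Phi(s) = c (s^al + s^(q/2)), al = q nu / (q - 1 + 2 nu) <= q/2.

   Rates.  Write r_n = K u_n - gd.  The quantity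
   t_n (<p_n, r_n> - J u_n) + (t_n^2 |r_n|^2 + |p_n|^2) / 2
   + \sum_(k <= n) tau_k J u_k is nonincreasing in n, and
   K v_n - gd = (p_0 - p_n) / t_n for the tau-weighted average v_n of the
   iterates; so the variational inequality at v_n bounds t_n |r_n| and |p_n|
   simultaneously, without any solution of the dual problem.  Since C |u_n - udag|^q <= |p_n| (|r_n| + delta) +
   Phi((|r_n| + delta)^2), both stopping rules follow from
   |p_n| = O(delta^(2 al - 1)) and |r_n| = O(delta). *)

Set Implicit Arguments.
Unset Strict Implicit.
Unset Printing Implicit Defensive.

(** * Real powers and index functions *)

(** For [nu < 1/2] the source condition need not place [xidag] in the range of the adjoint of [K],
    so the dual iterates may grow. The scale delta^(2 al - 1) measures that growth; it is
    identically 1 when [al = 1/2], i.e. for [q = 1] or [nu = 1/2]. The bound on |p_n| is implicit: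
    |p_n| returns on the right inside [Phi]. It is absorbed because, after rescaling, it occurs
    there with power at most [q < 2] against a square on the left. The discrepancy principle is more
    delicate, since the constant in |r_n| <= rho delta is prescribed: there the square in |p_n| is
    completed, not merely estimated. The fractional power is given only as a limit of polynomials in
    K^* K. The Bernstein basis is a partition of unity with nonnegative forms that reproduces the
    identity, so it acts as a discrete spectral measure and gives bounds uniform in the degree. In
    [Phi] the power s^(q/2) pays for the coordinates in [I], where |K z| controls |z| linearly, and
    s^al comes from the interpolation of the source term; the latter dominates near 0. *)

(** Weighted arithmetic-geometric mean. The endpoints are included because [nu = 1/2] leads to the
    exponents [2 * nu = 1] and [th = 1] below. *)
Lemma powR_young (R : realType) (a x y : R) : 0 <= a <= 1 -> 0 <= x -> 0 <= y ->
  x `^ a * y `^ (1 - a) <= a * x + (1 - a) * y.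
Proof.
move=> /andP[a0 a1] x0 y0.
have [->|an0] := eqVneq a 0; first by rewrite powRr0 subr0 powRr1 // !mul1r mul0r add0r.
have [->|an1] := eqVneq a 1.
  by rewrite subrr powRr0 powRr1 // mulr1 mul1r mul0r addr0.
have ap : 0 < a by rewrite lt_neqAle eq_sym an0.
have ap1 : 0 < 1 - a by rewrite subr_gt0 lt_neqAle an1.
have := @conjugate_powR R (x `^ a) (y `^ (1 - a)) a^-1 (1 - a)^-1
  (powR_ge0 _ _) (powR_ge0 _ _).
rewrite !invr_gt0 !invrK => /(_ ap ap1); rewrite subrKC => /(_ erefl).
rewrite -!powRrM !divff ?gt_eqF // !powRr1 // => /le_trans; apply.
by rewrite (mulrC x) (mulrC y).
Qed.

(** By concavity x^a lies below its tangent at [e]. The bound is affine in [x], so it can be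
    averaged against weights of which only the zeroth and first moments are known; [e] stays free
    for optimisation. *)
Lemma powR_tangent (R : realType) (a e x : R) : 0 <= a <= 1 -> 0 < e -> 0 <= x ->
  x `^ a <= a * e `^ (a - 1) * x + (1 - a) * e `^ a.
Proof.
move=> a01 e0 x0.
have ea0 : 0 < e `^ a by rewrite powR_gt0.
have := @powR_young R a (x / e) 1 a01 (divr_ge0 x0 (ltW e0)) ler01.
rewrite powR1 !mulr1 => h.
have -> : x `^ a = (x / e) `^ a * e `^ a.
  by rewrite -powRM ?divfK ?gt_eqF // ?divr_ge0 // ltW.
have -> : e `^ (a - 1) = e `^ a / e.
  by rewrite powRB ?powRr1 ?ltW //; apply/implyP => _; rewrite gt_eqF.
apply: le_trans (ler_wpM2r (ltW ea0) h) _.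
by rewrite le_eqVlt; apply/orP; left; apply/eqP; ring.
Qed.

Lemma ler_powRl (R : realType) (r x y : R) : 0 <= r -> 0 <= x -> x <= y ->
  x `^ r <= y `^ r.
Proof. by move=> r0 x0 xy; rewrite ge0_ler_powR // nnegrE ?x0 // (le_trans x0). Qed.

Lemma powR_addr_le (R : realType) (a x y : R) : 0 <= a -> 0 <= x -> 0 <= y ->
  (x + y) `^ a <= 2 `^ a * (x `^ a + y `^ a).
Proof.
move=> a0 x0 y0.
wlog xy : x y x0 y0 / x <= y => [hw|].
  by have [/hw|/ltW/hw h] := leP x y; [exact|rewrite addrC [_ `^ _ + _]addrC h].
apply: (@le_trans _ _ ((2 * y) `^ a)).
  by apply: ler_powRl => //; [rewrite addr_ge0|rewrite mulrC mulr_natr mulr2n lerD2r].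
rewrite powRM //; apply: ler_wpM2l; first exact: powR_ge0.
by rewrite lerDr powR_ge0.
Qed.

Lemma powR_sqr (R : realType) (a x : R) : 0 <= x -> (x ^+ 2) `^ a = x `^ (2 * a).
Proof. by move=> x0; rewrite -powR_mulrn // -powRrM. Qed.

Lemma powR_continuous_ge0 (R : realType) (a : R) : 0 < a ->
  {within `[0, +oo[, continuous (@powR R ^~ a)}.
Proof.
move=> a0; apply/continuous_within_itvcyP; split; last first.
  by rewrite powR0 ?gt_eqF //; exact: powR_cvg0.
move=> x; rewrite in_itv/= andbT => x0.
apply/differentiable_continuous/derivable1_diffP/derivable_powR.
by rewrite in_itv/= andbT.
Qed.

Lemma concave_powR (R : realType) (a t x y : R) : 0 < a <= 1 -> 0 <= t <= 1 ->
  0 <= x -> 0 <= y ->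
  t * x `^ a + (1 - t) * y `^ a <= (t * x + (1 - t) * y) `^ a.
Proof.
move=> /andP[a0 a1] /andP[t0 t1] x0 y0.
have t1' : 0 <= 1 - t by rewrite subr_ge0.
have tx : 0 <= t * x by rewrite mulr_ge0.
have ty : 0 <= (1 - t) * y by rewrite mulr_ge0.
have : 0 <= t * x + (1 - t) * y by rewrite addr_ge0.
rewrite le_eqVlt => /predU1P[/esym m0|m0].
  rewrite m0; move/eqP: m0; rewrite paddr_eq0 // => /andP[/eqP tx0 /eqP ty0].
  have z u v : u * v = 0 -> u * v `^ a = 0.
    by move=> /eqP; rewrite mulf_eq0 => /orP[] /eqP ->; rewrite ?powR0 ?mulr0 ?mul0r ?gt_eqF.
  by rewrite !z // addr0 powR_ge0.
(* Jensen from the tangent at the mean: the affine bounds at [x] and [y] average to the value at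
   [m]. *)
set m := _ + _ in m0 *.
have a01 : 0 <= a <= 1 by rewrite ltW.
have h u := @powR_tangent R a m u a01 m0.
apply: le_trans (lerD (ler_wpM2l t0 (h _ x0)) (ler_wpM2l t1' (h _ y0))) _.
have -> : m `^ (a - 1) = m `^ a / m.
  by rewrite powRB ?powRr1 ?ltW //; apply/implyP => _; rewrite gt_eqF.
rewrite le_eqVlt; apply/orP; left; apply/eqP.
rewrite [LHS](_ : _ = a * (m `^ a / m) * m + (1 - a) * m `^ a); last by rewrite /m; ring.
by rewrite -!mulrA mulVf ?gt_eqF //; ring.
Qed.

Definition powsum (R : realType) (c a b s : R) : R := c * (s `^ a + s `^ b).

Lemma powsum_index_function (R : realType) (c a b : R) :
  0 < c -> 0 < a <= 1 -> 0 < b <= 1 -> index_function (powsum c a b).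
Proof.
move=> c0 a01 b01; have [/andP[a0 a1] /andP[b0 b1]] := conj a01 b01.
split.
- have ca := @powR_continuous_ge0 R a a0; have cb := @powR_continuous_ge0 R b b0.
  by move=> x; apply: cvgMr; apply: cvgD; [exact: ca|exact: cb].
- move=> s t; rewrite !in_itv /= !andbT => s0 t0 st.
  rewrite /powsum ltr_pM2l // ltrD // gt0_ltr_powR //.
- move=> t x y; rewrite !inE /= !in_itv /= !andbT => x0 y0.
  rewrite !convRE /= /powsum.
  have ht : 0 <= t%:num <= 1 by apply/andP; split.
  have := @concave_powR R a t%:num x y a01 ht x0 y0.
  have := @concave_powR R b t%:num x y b01 ht x0 y0.
  rewrite /unstable.onem; set A := (_ + _) `^ a; set B := (_ + _) `^ b => hB hA.
  rewrite -subr_ge0 [X in 0 <= X](_ : _ = c * ((A - (t%:num * x `^ a + (1 - t%:num) * y `^ a)) +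
     (B - (t%:num * x `^ b + (1 - t%:num) * y `^ b)))); last by ring.
  by rewrite mulr_ge0 ?(ltW c0) // addr_ge0 // subr_ge0.
- by rewrite /powsum !powR0 ?gt_eqF // addr0 mulr0.
Qed.

Lemma powsum_asymp (R : realType) (c a b : R) : 0 < c -> a <= b ->
  asymp0 (fun s => (powsum c a b s)%:E) (fun s => s `^ a).
Proof.
move=> c0 ab; exists c, (c + c); split; rewrite ?addr_gt0 //.
near=> s.
have s0 : 0 < s by near: s; exact: nbhs_right_gt.
have s1 : s <= 1 by near: s; exact: nbhs_right_le.
rewrite !lee_fin /powsum mulrDr lerDl mulr_ge0 ?powR_ge0 ?(ltW c0) //=.
by rewrite mulrDl lerD2l ler_wpM2l ?(ltW c0) // ger_powR ?s0.
Unshelve. all: by end_near. Qed.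

Lemma index_inv_apply (R : realType) (Phi : R -> R) (r : R) :
  index_function Phi -> 0 <= r -> index_inv Phi (Phi r) = r%:E.
Proof.
move=> [_ mono _ _] r0; rewrite /index_inv.
rewrite (_ : [set _ | _ in _] = [set r%:E]) ?ereal_inf1 //.
apply/seteqP; split => [_ [s [s0 st] <-]|_ ->]; last by exists r.
have [sr|rs|-> //] := ltgtP s r; [have := mono s r|have := mono r s];
  rewrite !in_itv /= !andbT s0 r0 => /(_ isT isT); rewrite st ltxx.
- by move=> /(_ sr).
- by move=> /(_ rs).
Qed.

Lemma conjugate_inv_ge (R : realType) (Phi : R -> R) (s r : R) :
  index_function Phi -> 0 <= r -> ((s * Phi r - r)%:E <= conjugate_inv Phi s)%E.
Proof.
move=> iPhi r0; apply: ereal_sup_ubound; exists (Phi r) => /=; last first.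
  by rewrite index_inv_apply.
have [_ mono _ P0] := iPhi; move: r0; rewrite le_eqVlt => /predU1P[<-|r0]; first by rewrite P0.
by rewrite -P0 ltW // mono // in_itv /= ?lexx // ltW.
Qed.

(** Only points [t = Phi r] matter in the supremum: elsewhere the inverse is the infimum of the
    empty set, [+oo], and the term is [-oo]. *)
Lemma conjugate_inv_le (R : realType) (Phi : R -> R) (s M : R) :
  index_function Phi -> (forall r, 0 <= r -> s * Phi r - r <= M) ->
  (conjugate_inv Phi s <= M%:E)%E.
Proof.
move=> iPhi h; apply: ge_ereal_sup => _ [t _ <-].
have [[r [r0 <-]]|nr] := pselect (exists r, 0 <= r /\ Phi r = t).
  by rewrite index_inv_apply // lee_fin h.
rewrite (_ : index_inv Phi t = +oo%E) ?addeNy ?leNye //.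
rewrite /index_inv (_ : [set _ | _ in _] = set0) ?ereal_inf0 //.
by apply/seteqP; split => // z [r hr _]; apply: nr; exists r.
Qed.

(** The share [r / 2] is chosen so that two such bounds, one for each power in [powsum], add up to
    the [r] subtracted in the conjugate. *)
Lemma powR_young_half (R : realType) (a x r : R) : 0 < a < 1 -> 0 <= x -> 0 <= r ->
  x * r `^ a <= r / 2 + (2 * x) `^ (1 - a)^-1.
Proof.
move=> /andP[a0 a1] x0 r0.
have a01 : 0 <= a <= 1 by rewrite !ltW.
have x2 : 0 <= 2 * x by rewrite mulr_ge0.
have := @powR_young R a r _ a01 r0 (powR_ge0 (2 * x) (1 - a)^-1).
rewrite -powRrM mulVf ?gt_eqF ?subr_gt0 // powRr1 //.
set y := _ `^ _^-1; set z := r `^ a => h.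
have y0 : 0 <= y := powR_ge0 _ _.
have h2 : (1 - a) * y <= y by rewrite ler_piMl // gerBl ltW.
have h3 : a * r <= r by rewrite ler_piMl // ltW.
lra.
Qed.

Lemma conjugate_inv_powsum (R : realType) (c a b : R) :
  0 < c -> 0 < a -> a <= b -> b < 1 ->
  asymp0 (conjugate_inv (powsum c a b)) (fun s => s `^ (1 - a)^-1).
Proof.
move=> c0 a0 ab b1; have a1 : a < 1 := le_lt_trans ab b1; have b0 := lt_le_trans a0 ab.
have c20 : 0 < c / 2 by rewrite divr_gt0.
have iPhi : index_function (powsum c a b).
  by apply: powsum_index_function => //; apply/andP; split => //; exact: ltW.
exists ((c / 2) `^ (1 - a)^-1), ((2 * c) `^ (1 - a)^-1 + (2 * c) `^ (1 - b)^-1); split.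
- by rewrite powR_gt0.
- by rewrite addr_gt0 // powR_gt0 // mulr_gt0.
near=> s.
have s0 : 0 < s by near: s; exact: nbhs_right_gt.
have s1 : s <= 1 by near: s; exact: nbhs_right_le.
have k0 : (1 - a)^-1 * (1 - a) = 1 by rewrite mulVf // gt_eqF // subr_gt0.
apply/andP; split.
  (* This [r] solves r = (c / 2) s r^a, so the first power alone contributes s c r^a = 2 r and the
     supremum is at least 2 r - r. *)
  set r := (c / 2 * s) `^ (1 - a)^-1.
  have r0 : 0 <= r := powR_ge0 _ _.
  have -> : (c / 2) `^ (1 - a)^-1 * s `^ (1 - a)^-1 = r.
    by rewrite /r (@powRM _ (c / 2)) // ltW.
  apply: le_trans (conjugate_inv_ge s iPhi r0).
  rewrite lee_fin /powsum.
  have : r = c / 2 * s * r `^ a.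
    have {1}-> : c / 2 * s = r `^ (1 - a) by rewrite -powRrM k0 powRr1 // mulr_ge0 ?ltW.
    rewrite -powRD; last by rewrite subrK oner_eq0.
    by rewrite subrK powRr1.
  set z := r `^ a => hr.
  have : 0 <= s * (c * r `^ b) by rewrite !mulr_ge0 ?powR_ge0 ?ltW.
  lra.
apply: conjugate_inv_le => // r r0.
have sc : 0 <= s * c by rewrite mulr_ge0 ?ltW.
have ab1 (e : R) : 0 < e -> e < 1 -> 0 < e < 1 by move=> -> ->.
have := powR_young_half (ab1 _ a0 a1) sc r0.
have := powR_young_half (ab1 _ b0 b1) sc r0.
have c2 : 0 <= 2 * c by rewrite mulr_ge0 // ltW.
have e2 e : (2 * (s * c)) `^ e = (2 * c) `^ e * s `^ e.
  by rewrite -(@powRM _ (2 * c)) ?(ltW s0) //; congr (_ `^ _); ring.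
rewrite !e2 => hb ha.
(* Since [s <= 1] and [a <= b], the larger exponent coming from [b] is dominated by the one coming
   from [a]. *)
have : (2 * c) `^ (1 - b)^-1 * s `^ (1 - b)^-1 <= (2 * c) `^ (1 - b)^-1 * s `^ (1 - a)^-1.
  rewrite ler_wpM2l ?powR_ge0 // ger_powR ?s0 // lef_pV2 ?posrE ?subr_gt0 //.
  by rewrite lerD2l lerN2.
rewrite /powsum; move: ha hb; set z1 := r `^ a; set z2 := r `^ b.
move=> ha hb hs.
have -> : s * (c * (z1 + z2)) - r = (s * c * z1) + (s * c * z2) - r by ring.
rewrite mulrDl; lra.
Unshelve. all: by end_near. Qed.

(** * Hilbert spaces *)

Section hilbert_basics.
Context {R : realType} {X : completeNormedModType R}.
Implicit Types (dot : {dot X for idfun}) (x y z : X).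

Lemma dotC dot x y : dot x y = dot y x.
Proof. by rewrite hermC expr0 mul1r. Qed.

Lemma dotDl dot x y z : dot (x + y) z = dot x z + dot y z.
Proof. exact: linearDl. Qed.

Lemma dotDr dot x y z : dot z (x + y) = dot z x + dot z y.
Proof. exact: linearDr. Qed.

Lemma dotBl dot x y z : dot (x - y) z = dot x z - dot y z.
Proof. exact: linearBl. Qed.

Lemma dotBr dot x y z : dot z (x - y) = dot z x - dot z y.
Proof. exact: linearBr. Qed.

Lemma dotZl dot a x z : dot (a *: x) z = a * dot x z.
Proof. exact: linearZl_LR. Qed.

Lemma dotZr dot a x z : dot z (a *: x) = a * dot z x.
Proof. by rewrite dotC dotZl dotC. Qed.

Lemma dot0l dot z : dot 0 z = 0.
Proof. exact: linear0l. Qed.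

Lemma dot0r dot z : dot z 0 = 0.
Proof. exact: linear0r. Qed.

Lemma dotNr dot x z : dot z (- x) = - dot z x.
Proof. exact: linearNr. Qed.

Lemma dot_suml dot (I : Type) (s : seq I) (P : pred I) (F : I -> X) z :
  dot (\sum_(i <- s | P i) F i) z = \sum_(i <- s | P i) dot (F i) z.
Proof. exact: linear_sumlz. Qed.

Lemma dot_sumr dot (I : Type) (s : seq I) (P : pred I) (F : I -> X) z :
  dot z (\sum_(i <- s | P i) F i) = \sum_(i <- s | P i) dot z (F i).
Proof. exact: linear_sumr. Qed.

Variable (dot : {dot X for idfun}).
Hypothesis hilb : norm_of_dot dot.

Lemma dot_ge0 x : 0 <= dot x x.
Proof. by rewrite -hilb sqr_ge0. Qed.

Lemma cauchy_schwarz x y : `|dot x y| <= `|x| * `|y|.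
Proof.
rewrite -(@ler_pXn2r _ 2) ?nnegrE ?mulr_ge0 // exprMn !hilb real_normK ?num_real //.
have [y0|] := eqVneq (dot y y) 0.
  have -> : y = 0.
    by apply/eqP; rewrite -normr_eq0 -sqrf_eq0 hilb y0.
  by rewrite !dot0r expr0n mulr0.
move=> yn0; have y0 : 0 < dot y y by rewrite lt_neqAle eq_sym yn0 dot_ge0.
have := dot_ge0 (dot y y *: x - dot x y *: y).
rewrite !(dotBl, dotBr, dotZl, dotZr) (dotC _ y x).
rewrite [X in 0 <= X](_ : _ = dot y y * (dot x x * dot y y - dot x y ^+ 2)); last by ring.
by rewrite pmulr_rge0 // subr_ge0.
Qed.

Lemma dot_continuous y : continuous (dot^~ y).
Proof.
move=> x; apply/cvgrPdist_le => e e0.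
near=> z.
rewrite -dotBl (le_trans (cauchy_schwarz _ _)) //.
have y1 : 0 < `|y| + 1 by rewrite ltr_wpDl.
have : `|x - z| <= e / (`|y| + 1).
  by near: z; apply: cvgr_dist_le => //; rewrite divr_gt0.
rewrite ler_pdivlMr // => h; apply: le_trans h.
by rewrite ler_wpM2l // lerDl.
Unshelve. all: by end_near. Qed.

End hilbert_basics.

Section orthonormal.
Context {R : realType} {X : completeNormedModType R} (dot : {dot X for idfun}).
Hypothesis hilb : norm_of_dot dot.
Variable phi : nat -> X.
Hypothesis basis : orthonormal_basis dot phi.
Implicit Types (x y v w : X) (s : seq nat) (a : nat -> R).

Definition proj s v : X := \sum_(i <- s) dot (phi i) v *: phi i.

Lemma dot_orthonormal_sum s a j : uniq s ->
  dot (phi j) (\sum_(i <- s) a i *: phi i) = if j \in s then a j else 0.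
Proof.
move=> us; rewrite dot_sumr.
under eq_bigr do rewrite dotZr basis.1.
case: ifPn => js; last first.
  rewrite big_seq big1 // => i is_; case: eqP => [ji|_]; last by rewrite mulr0.
  by move: js; rewrite ji is_.
rewrite (bigD1_seq j) //= eqxx mulr1 big1 ?addr0 // => i ij.
by rewrite eq_sym (negbTE ij) mulr0.
Qed.

Lemma norm_orthonormal_sum s a : uniq s ->
  `|\sum_(i <- s) a i *: phi i| ^+ 2 = \sum_(i <- s) a i ^+ 2.
Proof.
move=> us; rewrite hilb dot_suml big_seq [RHS]big_seq; apply: eq_bigr => i is_.
by rewrite dotZl dot_orthonormal_sum // is_ expr2.
Qed.

Lemma dot_proj s v j : uniq s ->
  dot (phi j) (proj s v) = if j \in s then dot (phi j) v else 0.
Proof. exact: dot_orthonormal_sum. Qed.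

Lemma projB s v w : proj s (v - w) = proj s v - proj s w.
Proof.
by rewrite /proj -sumrB; apply: eq_bigr => i _; rewrite dotBr scalerBl.
Qed.

Lemma bessel s v : uniq s -> \sum_(i <- s) dot (phi i) v ^+ 2 <= `|v| ^+ 2.
Proof.
move=> us; have h := norm_orthonormal_sum (fun i => dot (phi i) v) us.
have := dot_ge0 hilb (v - proj s v).
have e : dot v (proj s v) = \sum_(i <- s) dot (phi i) v ^+ 2.
  by rewrite dot_sumr; apply: eq_bigr => i _; rewrite dotZr (dotC _ v) expr2.
rewrite !(dotBl, dotBr) (dotC _ (proj s v) v) -!hilb {3}/proj h !e; lra.
Qed.

Lemma norm_proj_le s v : uniq s -> `|proj s v| <= `|v|.
Proof.
move=> us; rewrite -(@ler_pXn2r _ 2) ?nnegrE // norm_orthonormal_sum //.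
exact: bessel.
Qed.

Lemma cvg_proj v : proj (index_iota 0 n) v @[n --> \oo] --> v.
Proof.
apply/cvgrPdist_lt => e e0.
have e2 : 0 < e / 2 by rewrite divr_gt0.
have [z [/= vz [s [a [_ zE]]]]] : ball v (e / 2) `&` lspan phi setT !=set0.
  by apply: basis.2; [exists v; exact: ballxx|exact: ball_open].
(* The sum of the indices of [z] is a crude bound for each of them. Past it the projection fixes
   [z], so the error is at most twice |v - z|. *)
exists (\sum_(i <- s) i).+1 => // n /= sn.
have un : uniq (index_iota 0 n) by exact: iota_uniq.
have zP : proj (index_iota 0 n) z = z.
  rewrite zE /proj.
  under eq_bigr do rewrite dot_sumr scaler_suml.
  rewrite exchange_big /= big_seq [RHS]big_seq; apply: eq_bigr => i is_.
  rewrite (bigD1_seq i) //=; last first.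
    rewrite mem_index_iota /= (leq_trans _ sn) // ltnS.
    by rewrite (big_rem i is_) /= leq_addr.
  rewrite dotZr basis.1 eqxx mulr1 big1 ?addr0 // => j ji.
  by rewrite dotZr basis.1 (negbTE ji) mulr0 scale0r.
have -> : v - proj (index_iota 0 n) v = (v - z) - proj (index_iota 0 n) (v - z).
  by rewrite projB zP opprB addrA subrK.
apply: le_lt_trans (ler_normB _ _) _.
have := norm_proj_le (v - z) un.
move: vz; rewrite -ball_normE /= => h1 h2.
by apply: le_lt_trans (lerD (lexx _) h2) _; lra.
Qed.

End orthonormal.

Section riesz.
Context {R : realType} {X : completeNormedModType R} (dot : {dot X for idfun}).
Hypothesis hilb : norm_of_dot dot.
Variable phi : nat -> X.
Hypothesis basis : orthonormal_basis dot phi.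

(** The representer is the series of f(phi_i) phi_i. Testing [f] on partial sums bounds the sum of
    squared coefficients by [k ^+ 2], completeness gives the limit, and two bounded functionals that
    agree on finite combinations of the basis agree everywhere. *)
Lemma riesz_representation (f : {linear X -> R^o}) (k : R) :
  (forall x, `|f x| <= k * `|x|) -> exists z, forall u, f u = dot u z.
Proof.
move=> fk.
have nphi i : `|phi i| = 1.
  by apply/eqP; rewrite -(@eqrXn2 _ 2) // hilb basis.1 eqxx expr1n.
have k0 : 0 <= k by have := fk (phi 0%N); rewrite nphi mulr1; apply: le_trans.
pose c i : R := f (phi i).
pose h i := c i *: phi i.
have normh s : uniq s -> `|\sum_(i <- s) h i| ^+ 2 = \sum_(i <- s) c i ^+ 2.
  exact: norm_orthonormal_sum.
have sumk s : uniq s -> \sum_(i <- s) c i ^+ 2 <= k ^+ 2.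
  move=> us; have := fk (\sum_(i <- s) h i).
  have -> : f (\sum_(i <- s) h i) = \sum_(i <- s) c i ^+ 2.
    by rewrite linear_sum; apply: eq_bigr => i _; rewrite linearZ.
  rewrite -normh //; set t := `|\sum_(i <- s) h i| => ht.
  rewrite lerXn2r ?nnegrE ?normr_ge0 //.
  have [t0|tn0] := eqVneq t 0; first by rewrite t0.
  have t0 : 0 < t by rewrite lt_neqAle eq_sym tn0 normr_ge0.
  by rewrite -(ler_pM2r t0) -expr2 (le_trans _ ht) // ler_norm.
have cvg2 : cvgn (series (fun i => c i ^+ 2)).
  apply: nondecreasing_is_cvgn.
    by apply: nondecreasing_series => i _ _; exact: sqr_ge0.
  by exists (k ^+ 2) => _ [n _ <-]; apply: sumk; exact: iota_uniq.
have cvgh : cvgn (series h).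
  apply: cauchy_cvg; apply/cauchy_seriesP => e e0.
  have /cauchy_cvgP /cauchy_seriesP /(_ (e ^+ 2) (exprn_gt0 2 e0)) := cvg2.
  apply: filterS => -[m n] /=; rewrite -normh; last exact: iota_uniq.
  by rewrite ger0_norm ?sqr_ge0 // ltr_pXn2r ?nnegrE ?normr_ge0 ?(ltW e0).
pose z := limn (series h); exists z.
have dz j : dot (phi j) z = c j.
  rewrite dotC; apply: (@cvg_unique _ (@Rhausdorff R) (dot (series h n) (phi j) @[n --> \oo])).
    by apply: (cvg_comp _ (dot^~ (phi j)) cvgh); exact: dot_continuous.
  apply: cvg_near_cst; exists j.+1 => // n /= jn.
  rewrite dotC /series /= (@dot_orthonormal_sum _ _ _ _ basis) ?iota_uniq //.
  by rewrite mem_index_iota /= jn.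
move=> u; apply/eqP; rewrite -subr_eq0 -normr_le0; apply/ler_addgt0Pr => e e0.
rewrite add0r.
have kz : 0 < k + `|z| + 1 by rewrite ltr_wpDl // addr_ge0.
have /cvgrPdist_le /(_ (e / (k + `|z| + 1))) := @cvg_proj _ _ _ hilb _ basis u.
rewrite divr_gt0 // => /(_ isT) [n _ /(_ n (leqnn n))] /=.
set w := proj _ _ _ _ => hw.
have -> : f u - dot u z = f (u - w) - dot (u - w) z.
  suff : f w = dot w z by move=> fw; rewrite linearB dotBl /= fw; ring.
  rewrite /w /proj linear_sum dot_suml; apply: eq_bigr => i _.
  by rewrite linearZ dotZl dz.
apply: le_trans (ler_normB _ _) _.
apply: le_trans (lerD (fk _) (cauchy_schwarz hilb _ _)) _.
move: hw; rewrite ler_pdivlMr // => hw; apply: le_trans hw.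
have : 0 <= `|u - w| by []. nra.
Qed.

End riesz.

Section adjoint.
Context {R : realType} {X H : completeNormedModType R}.
Variables (dotX : {dot X for idfun}) (dotH : {dot H for idfun}).
Hypotheses (hilbX : norm_of_dot dotX) (hilbH : norm_of_dot dotH).
Variables (phi : nat -> X) (basis : orthonormal_basis dotX phi).
Variables (K : {linear X -> H}) (k : R).
Hypothesis Kk : forall x, `|K x| <= k * `|x|.

(** [adjoint] is a choice with default 0; Riesz representation shows that the default is not
    taken. *)
Lemma adjointP u y : dotH (K u) y = dotX u (adjoint dotX dotH K y).
Proof.
rewrite /adjoint; case: xgetP => [x _ -> //|nz].
exfalso.
have lf : linear (fun u => dotH (K u) y : R^o).
  by move=> a v w; rewrite linearP dotDl dotZl.
pose m := GRing.isLinear.Build R X R^o _ _ lf.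
pose f : {linear X -> R^o} := HB.pack (fun u => dotH (K u) y : R^o) m.
have fk x : `|f x| <= (k * `|y|) * `|x|.
  rewrite (le_trans (cauchy_schwarz hilbH _ _)) // mulrAC ler_wpM2r //.
have [z hz] := riesz_representation hilbX basis fk.
by apply: (nz z) => v; exact: hz.
Qed.

End adjoint.

(** * Bernstein polynomials and fractional powers *)

Section binomial_moments.
Context {R : comNzRingType} (x y : R).

(** The moments are stated over a commutative ring because they serve both at the polynomials ['X],
    [M%:P - 'X] and at the reals [t], [M - t]. Powers of [x + y] are kept as factors, as nothing can
    be divided out. *)
Lemma binomial_moment0 n :
  \sum_(k < n.+1) 'C(n, k)%:R * x ^+ k * y ^+ (n - k) = (x + y) ^+ n.
Proof.
rewrite addrC exprDn; apply: eq_bigr => k _.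
by rewrite -mulrA mulr_natl (mulrC (x ^+ k)).
Qed.

(** The factor [k] is absorbed by k C(n+1, k) = (n+1) C(n, k-1) and a shift of the sum. A constant
    [g] gives the first moment, the identity gives the second. *)
Lemma binomial_shift (g : nat -> R) n :
  \sum_(k < n.+2) k%:R * g k * ('C(n.+1, k)%:R * x ^+ k * y ^+ (n.+1 - k)) =
  n.+1%:R * x * \sum_(k < n.+1) g k.+1 * ('C(n, k)%:R * x ^+ k * y ^+ (n - k)).
Proof.
rewrite big_ord_recl !mul0r add0r mulr_sumr; apply: eq_bigr => k _.
rewrite lift0 subSS.
have /(congr1 (fun m : nat => m%:R : R)) := mul_bin_diag n.+1 k.
rewrite !natrM /= => e.
rewrite [LHS](_ : _ = (k.+1%:R * 'C(n.+1, k.+1)%:R) * (g k.+1 * x ^+ k.+1 * y ^+ (n - k))); last by ring.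
by rewrite -e exprS; ring.
Qed.

Lemma binomial_moment1 n :
  (x + y) * \sum_(k < n.+1) k%:R * ('C(n, k)%:R * x ^+ k * y ^+ (n - k)) =
  n%:R * x * (x + y) ^+ n.
Proof.
case: n => [|n]; first by rewrite big_ord1 !mul0r mulr0.
have := binomial_shift (fun=> 1) n.
under eq_bigr do rewrite mulr1; move=> ->.
under eq_bigr do rewrite mul1r; rewrite binomial_moment0 exprS; ring.
Qed.

Lemma binomial_moment2 n :
  (x + y) ^+ 2 * \sum_(k < n.+2) k%:R ^+ 2 * ('C(n.+1, k)%:R * x ^+ k * y ^+ (n.+1 - k)) =
  n.+1%:R * x * (n%:R * x + (x + y)) * (x + y) ^+ n.+1.
Proof.
have := binomial_shift (fun k => k%:R) n.
under eq_bigr do rewrite -expr2; move=> ->.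
under eq_bigr do rewrite -natr1 mulrDl mul1r.
rewrite big_split /= binomial_moment0.
rewrite [LHS](_ : _ = n.+1%:R * x * (x + y) *
  ((x + y) * (\sum_(i < n.+1) i%:R * ('C(n, i)%:R * x ^+ i * y ^+ (n - i)))
   + (x + y) * (x + y) ^+ n)); last by ring.
by rewrite binomial_moment1 exprS; ring.
Qed.

End binomial_moments.

(** The shares x / (x + y) and y / (x + y) lie in [0, 1], where a power [a <= 1] can only increase
    them, and they sum to 1. *)
Lemma powR_subadd (R : realType) (a x y : R) : 0 < a <= 1 -> 0 <= x -> 0 <= y ->
  (x + y) `^ a <= x `^ a + y `^ a.
Proof.
move=> /andP[a0 a1] x0 y0.
have : 0 <= x + y by rewrite addr_ge0.
rewrite le_eqVlt => /predU1P[s0|s0].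
  by rewrite -s0 powR0 ?gt_eqF // addr_ge0 // powR_ge0.
have h z : 0 <= z -> z <= x + y -> z / (x + y) * (x + y) `^ a <= z `^ a.
  move=> z0 zs; have [->|zn0] := eqVneq z 0; first by rewrite !mul0r powR_ge0.
  have zz : z / (x + y) <= (z / (x + y)) `^ a.
    have z1 : 0 < z by rewrite lt_neqAle eq_sym zn0.
    by apply: ger1_powR => //; rewrite divr_gt0 //= ler_pdivrMr // mul1r.
  apply: le_trans (ler_wpM2r (powR_ge0 _ _) zz) _.
  by rewrite -powRM ?divr_ge0 ?(ltW s0) // divfK // gt_eqF.
apply: le_trans (lerD (h _ x0 _) (h _ y0 _)); last 2 first.
- by rewrite lerDl.
- by rewrite lerDr.
by rewrite -!mulrDl divff ?gt_eqF // mul1r.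
Qed.

Lemma powR_holder (R : realType) (a x y : R) : 0 < a <= 1 -> 0 <= x -> 0 <= y ->
  `|x `^ a - y `^ a| <= `|x - y| `^ a.
Proof.
move=> a01.
have aux u v : 0 <= v -> v <= u -> `|u `^ a - v `^ a| <= `|u - v| `^ a.
  move=> v0 vu; have a0 : 0 <= a by case/andP: a01 => /ltW.
  have uv0 : 0 <= u - v by rewrite subr_ge0.
  rewrite !ger0_norm ?subr_ge0 // ?ler_powRl //.
  by rewrite lerBlDr -{1}(subrK v u) powR_subadd.
move=> x0 y0; have [xy|/ltW yx] := leP x y; last exact: aux.
by rewrite distrC [X in _ <= X `^ _]distrC; exact: aux.
Qed.

Section bernstein.
Context {R : realType} (M : R) (M0 : 0 < M).

(** The Bernstein basis rescaled to [0, [M]], kept as polynomials because it is evaluated both at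
    reals and at an operator. *)
Definition bernstein_basis n k : {poly R} :=
  (M ^- n * 'C(n, k)%:R) *: ('X ^+ k * (M%:P - 'X) ^+ (n - k)).

Lemma bernstein_basisE n k (t : R) : (bernstein_basis n k).[t] =
  M ^- n * ('C(n, k)%:R * t ^+ k * (M - t) ^+ (n - k)).
Proof. by rewrite /bernstein_basis !hornerE /=; ring. Qed.

Let Mn0 n : M ^+ n != 0.
Proof. by rewrite expf_neq0 // gt_eqF. Qed.

Let bernsteinPE n k : bernstein_basis n k =
  (M ^- n)%:P * ('C(n, k)%:R * 'X ^+ k * (M%:P - 'X) ^+ (n - k)).
Proof.
by rewrite /bernstein_basis -mul_polyC polyCM polyC_natr -!mulrA.
Qed.

Lemma sum_bernstein n : \sum_(k < n.+1) bernstein_basis n k = 1.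
Proof.
under eq_bigr do rewrite bernsteinPE.
by rewrite -mulr_sumr binomial_moment0 subrKC -polyC_exp -polyCM mulVf.
Qed.

(** With [sum_bernstein] this says that the basis reproduces affine functions of the nodes, which is
    why tangent bounds at the nodes sum up exactly. Degree [n.+1] keeps the denominator nonzero. *)
Lemma sum_bernstein_id n :
  \sum_(k < n.+2) (M * k%:R / n.+1%:R) *: bernstein_basis n.+1 k = 'X.
Proof.
have Mp : M%:P != 0 :> {poly R} by rewrite polyC_eq0 gt_eqF.
have := @binomial_moment1 _ 'X (M%:P - 'X : {poly R}) n.+1.
rewrite subrKC => h.
under eq_bigr => k _ do rewrite bernsteinPE -mul_polyC polyCM polyCM polyC_natr.
rewrite [LHS](_ : _ = (M ^- n.+1 / n.+1%:R)%:P *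
  (M%:P * \sum_(k < n.+2) k%:R * ('C(n.+1, k)%:R * 'X ^+ k * (M%:P - 'X) ^+ (n.+1 - k)))); last first.
  by rewrite !mulr_sumr; apply: eq_bigr => k _; rewrite polyCM; ring.
rewrite h -polyC_natr -polyC_exp.
rewrite [LHS](_ : _ = ((M ^- n.+1 / n.+1%:R) * n.+1%:R * M ^+ n.+1)%:P * 'X).
  by rewrite divfK ?pnatr_eq0 // mulVf // mul1r.
by rewrite !polyCM; ring.
Qed.

(** For [t] in [0, [M]] this is the variance of [M / n.+1] times a binomial variable with success
    probability [t / M]. *)
Lemma bernstein_variance n (t : R) :
  \sum_(k < n.+2) (M * k%:R / n.+1%:R - t) ^+ 2 * (bernstein_basis n.+1 k).[t] =
  t * (M - t) / n.+1%:R.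
Proof.
have h0 := @binomial_moment0 _ t (M - t) n.+1.
have h1 := @binomial_moment1 _ t (M - t) n.+1.
have h2 := @binomial_moment2 _ t (M - t) n.
rewrite subrKC in h0 h1 h2.
under eq_bigr do rewrite bernstein_basisE.
pose b (k : 'I_n.+2) := 'C(n.+1, k)%:R * t ^+ k * (M - t) ^+ (n.+1 - k).
rewrite [LHS](_ : _ = M ^- n.+1 * (n.+1%:R ^- 2 * (M ^+ 2 * \sum_(k < n.+2) k%:R ^+ 2 * b k)
  - (2 * t / n.+1%:R) * (M * \sum_(k < n.+2) k%:R * b k) + t ^+ 2 * \sum_(k < n.+2) b k)); last first.
  rewrite !mulr_sumr -sumrB -big_split /= mulr_sumr; apply: eq_bigr => k _.
  rewrite -/(b k); field.
  by rewrite gt_eqF //= gt_eqF // addrC natr1 ltr0n.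
rewrite h0 h1 h2.
have N0 : n.+1%:R != 0 :> R by rewrite pnatr_eq0.
rewrite [LHS](_ : _ = (M ^- n.+1 * M ^+ n.+1) * (n.+1%:R ^- 2 * (n.+1%:R * t * (n%:R * t + M)) - 2 * t / n.+1%:R * (n.+1%:R * t) + t ^+ 2)); last by ring.
rewrite mulVf // mul1r -natr1.
by field; rewrite natr1.
Qed.

End bernstein.

Section bernstein_approximation.
Context {R : realType} (M : R) (M0 : 0 < M) (nu : R) (nu01 : 0 < nu <= 1).

Definition bernstein_powR n : {poly R} :=
  \sum_(k < n.+2) ((M * k%:R / n.+1%:R) `^ nu) *: bernstein_basis M n.+1 k.

(** Quantitative Weierstrass approximation: Hoelder continuity bounds the deviation at a node by ((x
    - t)^2)^(nu/2), whose tangent bound is linear in (x - t)^2 and averages to the variance. *)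
Lemma bernstein_powR_le n t : 0 <= t <= M ->
  `|(bernstein_powR n).[t] - t `^ nu| <= (M ^+ 2 + 1) * (n.+1%:R^-1) `^ (nu / 2).
Proof.
move=> /andP[t0 tM]; have [nu0 nu1] := andP nu01.
have b0 k : 0 <= (bernstein_basis M n.+1 k).[t].
  by rewrite bernstein_basisE !mulr_ge0 ?invr_ge0 ?exprn_ge0 ?subr_ge0 // ltW.
have sb : \sum_(k < n.+2) (bernstein_basis M n.+1 k).[t] = 1.
  by rewrite -horner_sum sum_bernstein // hornerE.
have -> : t `^ nu = \sum_(k < n.+2) t `^ nu * (bernstein_basis M n.+1 k).[t].
  by rewrite -mulr_sumr sb mulr1.
rewrite /bernstein_powR horner_sum -sumrB.
(* The tangent point has the order of the variance, which balances the two terms of the tangent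
   bound. *)
set e : R := n.+1%:R^-1; have e0 : 0 < e by rewrite invr_gt0.
set a := nu / 2.
have a01 : 0 <= a <= 1 by rewrite /a; lra.
pose x (k : 'I_n.+2) : R := M * k%:R / n.+1%:R.
have hx k : `|x k `^ nu - t `^ nu| <= a * e `^ (a - 1) * (x k - t) ^+ 2 + (1 - a) * e `^ a.
  have xk0 : 0 <= x k by rewrite /x !mulr_ge0 // ltW.
  apply: le_trans (powR_holder nu01 xk0 t0) _.
  have -> : `|x k - t| `^ nu = ((x k - t) ^+ 2) `^ a.
    by rewrite -real_normK ?num_real // powR_sqr // /a mulrC divfK.
  by apply: powR_tangent => //; exact: sqr_ge0.
apply: (@le_trans _ _ (\sum_(k < n.+2) (a * e `^ (a - 1) * (x k - t) ^+ 2 + (1 - a) * e `^ a)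
    * (bernstein_basis M n.+1 k).[t])).
  apply: le_trans (ler_norm_sum _ _ _) _; apply: ler_sum => k _.
  rewrite hornerZ -mulrBl normrM (ger0_norm (b0 k)); apply: ler_wpM2r => //; exact: hx.
under eq_bigr do rewrite mulrDl.
rewrite big_split /= -mulr_sumr sb mulr1.
under eq_bigr do rewrite -mulrA.
rewrite -mulr_sumr bernstein_variance // -/e.
have ea0 : 0 <= e `^ a := powR_ge0 _ _.
rewrite [leRHS]mulrDl mul1r lerD //; last by rewrite ler_piMl // gerBl; case/andP: a01.
rewrite [leLHS](_ : _ = a * (t * (M - t)) * (e `^ (a - 1) * e)); last by rewrite /e; ring.
have -> : e `^ (a - 1) * e = e `^ a.
  rewrite powRB; last by apply/implyP => _; rewrite gt_eqF.
  by rewrite powRr1 ?(ltW e0) // divfK // gt_eqF.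
apply: ler_wpM2r => //.
have : 0 <= t * (M - t) by rewrite mulr_ge0 // subr_ge0.
have : t * (M - t) <= M ^+ 2 by rewrite expr2; apply: ler_pM; rewrite ?subr_ge0 ?gerBl.
case/andP: a01 => ? ? ? ?; nra.
Qed.

(** Any [c <= M] is allowed because [cfc] tests convergence on [0, [opnorm A]], while [M] will only
    be an upper bound for that norm. *)
Lemma bernstein_powR_cvg (c : R) : c <= M ->
  {uniform `[0, c], (fun n => horner (bernstein_powR n) : R -> R) @ \oo --> (fun t => t `^ nu)}.
Proof.
move=> cM P /uniform_nbhs[E [entE EP]]; have [nu0 nu1] := andP nu01.
have [e /= e0 eE] : exists2 e : R, 0 < e & forall x y : R, `|x - y| < e -> E (x, y).
  move: entE; rewrite -entourage_ballE => -[e /= e0 eE]; exists e => // x y xy.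
  by apply: eE; rewrite /= -ball_normE.
have cv : (M ^+ 2 + 1) * (n.+1%:R^-1) `^ (nu / 2) @[n --> \oo] --> (0 : R).
  rewrite -[X in _ --> X](mulr0 (M ^+ 2 + 1)); apply: cvgMr.
  apply: (@cvg_comp _ _ _ (fun n : nat => n.+1%:R^-1 : R) (fun x => x `^ (nu / 2)) _ (0^'+)); last first.
    by apply: powR_cvg0; rewrite divr_gt0.
  move=> A [d /= d0 dA].
  have /cvgrPdist_lt /(_ d d0) := @cvg_harmonic R.
  apply: filterS => n; rewrite sub0r normrN /= /harmonic => h.
  by apply: dA; rewrite /= ?sub0r ?normrN // invr_gt0.
have /cvgrPdist_lt /(_ e e0) := cv.
apply: filterS => n; rewrite sub0r normrN => h.
apply: EP => t /=; rewrite in_itv /= => /andP[t0 tc].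
apply: eE; rewrite distrC; apply: le_lt_trans (bernstein_powR_le n _) _.
  by rewrite t0 (le_trans tc).
by apply: le_lt_trans h; exact: ler_norm.
Qed.

End bernstein_approximation.

(** * Polynomials in a nonnegative self-adjoint operator *)

Section positive_operator.
Context {R : realType} {X : completeNormedModType R} (dot : {dot X for idfun}).
Hypothesis hilb : norm_of_dot dot.
Variables (A : X -> X) (M : R).
Hypothesis M0 : 0 < M.
Hypothesis Alin : forall a x y, A (a *: x + y) = a *: A x + A y.
Hypothesis Asym : forall x y, dot (A x) y = dot x (A y).
Hypothesis Apos : forall x, 0 <= dot (A x) x.
Hypothesis AleM : forall x, dot (A x) x <= M * `|x| ^+ 2.
Hypothesis Asqr : forall x, `|A x| ^+ 2 <= M * dot (A x) x.
Implicit Types (x y w : X) (P Q : {poly R}).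

Definition poly_form P x w : R := dot (poly_op P A x) w.

Lemma iter_lin n a x y : iter n A (a *: x + y) = a *: iter n A x + iter n A y.
Proof. by elim: n => //= n ->. Qed.

Lemma poly_formE n P x w : (size P <= n)%N ->
  poly_form P x w = \sum_(i < n) P`_i * dot (iter i A x) w.
Proof.
move=> Pn; rewrite /poly_form /poly_op dot_suml.
under eq_bigr do rewrite dotZl.
rewrite (big_ord_widen n (fun i => P`_i * dot (iter i A x) w)) //.
rewrite big_mkcond; apply: eq_bigr => i _; case: ltnP => // h.
by rewrite nth_default // mul0r.
Qed.

Lemma poly_form_lin a P Q x w :
  poly_form (a *: P + Q) x w = a * poly_form P x w + poly_form Q x w.
Proof.
pose n := (size (a *: P + Q)%R + size P + size Q)%N.
have [nPQ nP nQ] : [/\ size (a *: P + Q)%R <= n, size P <= n & size Q <= n]%N.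
  by split; rewrite /n; lia.
rewrite !(@poly_formE n) //.
by rewrite mulr_sumr -big_split; apply: eq_bigr => i _; rewrite coefD coefZ /=; ring.
Qed.

Lemma poly_form0 x w : poly_form 0 x w = 0.
Proof. by rewrite (@poly_formE 0%N) ?size_poly0 // big_ord0. Qed.

Lemma poly_formZ a P x w : poly_form (a *: P) x w = a * poly_form P x w.
Proof. by rewrite -[a *: P]addr0 poly_form_lin poly_form0 addr0. Qed.

Lemma poly_formD P Q x w : poly_form (P + Q) x w = poly_form P x w + poly_form Q x w.
Proof. by rewrite -[P]scale1r poly_form_lin mul1r scale1r. Qed.

Lemma poly_formB P Q x w : poly_form (P - Q) x w = poly_form P x w - poly_form Q x w.
Proof. by rewrite addrC -scaleN1r poly_form_lin mulN1r addrC. Qed.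

Lemma poly_form_sum n (F : 'I_n -> {poly R}) x w :
  poly_form (\sum_(i < n) F i) x w = \sum_(i < n) poly_form (F i) x w.
Proof.
elim/big_ind2: _ => [|P a Q b <- <-|//]; first exact: poly_form0.
exact: poly_formD.
Qed.

Lemma poly_form1 x w : poly_form 1 x w = dot x w.
Proof. by rewrite (@poly_formE 1%N) ?size_poly1 // big_ord1 coef1 mul1r. Qed.

Lemma poly_formMX P x w : poly_form ('X * P) x w = poly_form P (A x) w.
Proof.
rewrite (@poly_formE (size P).+1); last first.
  by rewrite (leq_trans (size_polyMleq _ _)) // size_polyX.
rewrite (@poly_formE (size P)) // big_ord_recl coefXM mul0r add0r.
by apply: eq_bigr => i _; rewrite coefXM /= -iterS iterSr.
Qed.

Lemma poly_formX x w : poly_form 'X x w = dot (A x) w.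
Proof. by rewrite -['X]mulr1 poly_formMX poly_form1. Qed.

Lemma poly_form_linl a P x y w :
  poly_form P (a *: x + y) w = a * poly_form P x w + poly_form P y w.
Proof.
rewrite !(@poly_formE (size P)) // mulr_sumr -big_split; apply: eq_bigr => i _.
by rewrite iter_lin dotDl dotZl /=; ring.
Qed.

Lemma poly_form0l P w : poly_form P 0 w = 0.
Proof.
have := poly_form_linl 1 P 0 0 w; rewrite scale1r addr0 mul1r => /eqP.
by rewrite -subr_eq0 opprD addNKr oppr_eq0 => /eqP.
Qed.

Lemma poly_formZl a P x w : poly_form P (a *: x) w = a * poly_form P x w.
Proof. by rewrite -[a *: x]addr0 poly_form_linl poly_form0l addr0. Qed.

Lemma poly_formDl P x y w : poly_form P (x + y) w = poly_form P x w + poly_form P y w.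
Proof. by rewrite -[x]scale1r poly_form_linl mul1r scale1r. Qed.

Lemma poly_formBl P x y w : poly_form P (x - y) w = poly_form P x w - poly_form P y w.
Proof. by rewrite poly_formDl -scaleN1r poly_formZl mulN1r. Qed.

Lemma poly_formC P x w : poly_form P x w = poly_form P w x.
Proof.
rewrite !(@poly_formE (size P)) //; apply: eq_bigr => i _; congr (_ * _).
by elim: (nat_of_ord i) x w => [|n IH] x w; [rewrite /= dotC|rewrite iterSr IH iterS Asym].
Qed.

Lemma poly_form_adj P x w : poly_form P (A x) w = poly_form P x (A w).
Proof. by rewrite -poly_formMX poly_formC poly_formMX poly_formC. Qed.

Let D x := M *: x - A x.

Lemma poly_formMBX P x w : poly_form ((M%:P - 'X) * P) x w = poly_form P (D x) w.
Proof.
by rewrite mulrBl poly_formB poly_formMX mul_polyC poly_formZ /D poly_formBl poly_formZl.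
Qed.

Lemma poly_form_adjB P x w : poly_form P (D x) w = poly_form P x (D w).
Proof. by rewrite -poly_formMBX poly_formC poly_formMBX poly_formC. Qed.

(* Peeling off squares of [A] and of [M - A] leaves exponents at most 1. *)
Lemma poly_form_ge0 k m x : 0 <= poly_form ('X ^+ k * (M%:P - 'X) ^+ m) x x.
Proof.
have [n] := ubnP (k + m)%N; elim: n k m x => // n IH k m x.
rewrite ltnS => kmn.
have [k2|k2] := leqP 2 k.
  rewrite -(subnK k2) addn2 !exprS -!mulrA !poly_formMX poly_form_adj.
  by apply: IH; lia.
have [m2|m2] := leqP 2 m.
  rewrite -(subnK m2) addn2 !exprS mulrCA [X in _ * X]mulrCA.
  rewrite !poly_formMBX poly_form_adjB.
  by apply: IH; lia.
have Dx : dot (D x) x = M * `|x| ^+ 2 - dot (A x) x by rewrite dotBl dotZl hilb.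
case: k k2 kmn => [|[|//]] _ _; case: m m2 => [|[|//]] _.
- by rewrite !expr0 mulr1 poly_form1 -hilb sqr_ge0.
- by rewrite expr0 mul1r expr1 -[_ - _]mulr1 poly_formMBX poly_form1 Dx subr_ge0.
- by rewrite expr0 mulr1 expr1 poly_formX.
(* The mixed case [k = m = 1] is M <A x, x> - |A x|^2, which is nonnegative by [Asqr]. *)
rewrite !expr1 -['X * _]mulr1 -mulrA poly_formMX poly_formMBX poly_form1.
by rewrite /D dotBl dotZl (Asym (A x) x) -hilb subr_ge0.
Qed.

(** Nonnegativity of the form at [mu *: x - f *: w], divided by [mu]. The factor [f] goes with [w]
    only, so that one [mu] can serve all nodes at once. *)
Lemma poly_form_young P (mu f : R) x w : 0 < mu -> (forall x, 0 <= poly_form P x x) ->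
  2 * (f * poly_form P x w) <= mu * poly_form P x x + mu^-1 * (f ^+ 2 * poly_form P w w).
Proof.
move=> mu0 Pge0; have := Pge0 (mu *: x - f *: w).
rewrite poly_formBl !poly_formZl poly_formC (poly_formC P w) !poly_formBl !poly_formZl.
rewrite (poly_formC P w x).
set a := poly_form P x x; set b := poly_form P x w; set c := poly_form P w w => h.
have : 0 <= mu^-1 * (mu * (mu * a - f * b) - f * (mu * b - f * c)).
  by rewrite mulr_ge0 // invr_ge0 (ltW mu0).
rewrite [X in 0 <= X -> _](_ : _ = mu * a - 2 * (f * b) + mu^-1 * (f ^+ 2 * c)); last first.
  by field; rewrite gt_eqF.
lra.
Qed.

Lemma bernstein_basis_form_ge0 n k x : 0 <= poly_form (bernstein_basis M n k) x x.
Proof.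
by rewrite poly_formZ mulr_ge0 ?poly_form_ge0 // mulr_ge0 // invr_ge0 exprn_ge0 // (ltW M0).
Qed.

(** At each node Young's inequality is applied with factor t_k^nu, and the square t_k^(2 nu) is
    replaced by its tangent at [e], affine in t_k because [2 * nu <= 1]. The moments of the basis
    then produce <A w, w> and |w|^2 exactly, so the bound does not depend on [n]. *)
Lemma bernstein_powR_form_le (nu mu e : R) n x w :
  0 < nu <= 1 / 2 -> 0 < mu -> 0 < e ->
  2 * poly_form (bernstein_powR M nu n) x w <=
  mu * `|x| ^+ 2 + mu^-1 * (2 * nu * e `^ (2 * nu - 1) * dot (A w) w
                            + (1 - 2 * nu) * e `^ (2 * nu) * `|w| ^+ 2).
Proof.
move=> nu01 mu0 e0.
pose b k u v := poly_form (bernstein_basis M n.+1 k) u v.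
pose t (k : nat) := M * k%:R / n.+1%:R.
have b0 k u : 0 <= b k u u := bernstein_basis_form_ge0 _ _ _.
have t0 k : 0 <= t k by rewrite /t !mulr_ge0 // ltW.
have sb u : \sum_(k < n.+2) b k u u = `|u| ^+ 2.
  by rewrite /b -poly_form_sum sum_bernstein // poly_form1 hilb.
have st u : \sum_(k < n.+2) t k * b k u u = dot (A u) u.
  rewrite -poly_formX -(sum_bernstein_id M0 n) poly_form_sum.
  by apply: eq_bigr => k _; rewrite poly_formZ.
rewrite /bernstein_powR poly_form_sum mulr_sumr -sb -st -sb.
apply: (@le_trans _ _ (\sum_(k < n.+2) (mu * b k x x + mu^-1 *
   ((2 * nu * e `^ (2 * nu - 1) * t k + (1 - 2 * nu) * e `^ (2 * nu)) * b k w w)))).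
  apply: ler_sum => k _; rewrite poly_formZ.
  apply: le_trans (poly_form_young (t k `^ nu) x w mu0 (b0 k)) _.
  rewrite lerD2l ler_wpM2l ?invr_ge0 ?(ltW mu0) // ler_wpM2r //; first exact: b0.
  rewrite -powR_mulrn ?powR_ge0 // -powRrM mulrC.
  by apply: powR_tangent => //; lra.
rewrite big_split /= -!mulr_sumr.
under [X in _ + _ * X <= _]eq_bigr do rewrite mulrDl -mulrA.
by rewrite big_split /= -!mulr_sumr.
Qed.

End positive_operator.

(** * Interpolation inequality for the source element *)

Section source_interpolation.
Context {R : realType} {X H : completeNormedModType R}.
Variables (dotX : {dot X for idfun}) (dotH : {dot H for idfun}).
Hypotheses (hilbX : norm_of_dot dotX) (hilbH : norm_of_dot dotH).
Variables (phi : nat -> X) (basis : orthonormal_basis dotX phi).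
Variables (K : {linear X -> H}) (k : R).
Hypothesis k0 : 0 <= k.
Hypothesis Kk : forall x, `|K x| <= k * `|x|.
Variables (nu : R) (nu_range : 0 < nu <= 1 / 2).

Let A (x : X) : X := adjoint dotX dotH K (K x).
(** The summand 1 keeps [M] positive when [k = 0]; the Bernstein basis divides by powers of [M]. *)
Let M : R := k ^+ 2 + 1.

Let M0 : 0 < M.
Proof. by rewrite /M ltr_wpDl ?sqr_ge0. Qed.

Let dotA x w : dotX (A x) w = dotH (K x) (K w).
Proof. by rewrite dotC -(adjointP hilbX hilbH basis Kk) dotC. Qed.

Let adjoint_le y : `|adjoint dotX dotH K y| <= k * `|y|.
Proof.
set z := adjoint _ _ _ _.
have [->|zn0] := eqVneq z 0; first by rewrite normr0 mulr_ge0.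
have z0 : 0 < `|z| by rewrite normr_gt0.
rewrite -(ler_pM2r z0) -expr2 hilbX -(adjointP hilbX hilbH basis Kk).
apply: le_trans (ler_norm _) _; apply: le_trans (cauchy_schwarz hilbH _ _) _.
by rewrite mulrAC ler_wpM2r.
Qed.

(** [adjoint] being a choice, linearity is read off from inner products: the difference of the two
    sides is orthogonal to itself. *)
Let Alin a x y : A (a *: x + y) = a *: A x + A y.
Proof.
apply/eqP; rewrite -subr_eq0 -normr_eq0 -sqrf_eq0 hilbX.
set d := (X in dotX X X); rewrite {1}/d dotBl dotDl dotZl !dotA linearP dotDl dotZl.
by rewrite subrr.
Qed.

Let Asym x w : dotX (A x) w = dotX x (A w).
Proof. by rewrite dotA (dotC dotX) dotA dotC. Qed.

Let dotAA x : dotX (A x) x = `|K x| ^+ 2.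
Proof. by rewrite dotA hilbH. Qed.

Let Apos x : 0 <= dotX (A x) x.
Proof. by rewrite dotAA sqr_ge0. Qed.

Let k2M : k ^+ 2 <= M. Proof. by rewrite lerDl. Qed.

Let AleM x : dotX (A x) x <= M * `|x| ^+ 2.
Proof.
rewrite dotAA; apply: (@le_trans _ _ ((k * `|x|) ^+ 2)).
  by rewrite lerXn2r ?nnegrE ?normr_ge0 // mulr_ge0.
by rewrite exprMn ler_wpM2r ?sqr_ge0.
Qed.

Let Asqr x : `|A x| ^+ 2 <= M * dotX (A x) x.
Proof.
rewrite dotAA; apply: (@le_trans _ _ ((k * `|K x|) ^+ 2)).
  by rewrite lerXn2r ?nnegrE ?normr_ge0 ?adjoint_le // mulr_ge0.
by rewrite exprMn ler_wpM2r ?sqr_ge0.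
Qed.

Let opnormA : opnorm A <= M.
Proof.
apply: ge_sup.
  by exists `|A 0|; exists 0 => //=; rewrite normr0.
move=> _ [x /= x1 <-].
apply: (le_trans (adjoint_le _)); apply: le_trans (ler_wpM2l k0 (Kk _)) _.
rewrite mulrA -expr2; apply: le_trans k2M.
by rewrite ler_piMr // sqr_ge0.
Qed.

(* [op_powR] is the limit along every polynomial sequence approximating t^nu
   uniformly, so it may be computed along the Bernstein polynomials; it is the
   default value 0 if there is no such limit. *)
Lemma op_powR_young (p w : X) (mu e : R) : 0 < mu -> 0 < e ->
  2 * dotX (op_powR A nu p) w <= mu * `|p| ^+ 2 +
    mu^-1 * (2 * nu * e `^ (2 * nu - 1) * `|K w| ^+ 2 + (1 - 2 * nu) * e `^ (2 * nu) * `|w| ^+ 2).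
Proof.
move=> mu0 e0; have [nu0 nu1] := andP nu_range; rewrite -dotAA.
rewrite /op_powR /cfc; case: xgetP => [xi _ xiP|_]; last first.
  rewrite dot0l mulr0 addr_ge0 // mulr_ge0 ?(ltW mu0) ?sqr_ge0 ?invr_ge0 ?(ltW mu0) //.
  have nu2 : 0 <= 1 - 2 * nu by lra.
  by rewrite addr_ge0 // !mulr_ge0 ?powR_ge0 ?sqr_ge0 ?(ltW nu0).
have nu01 : 0 < nu <= 1 by lra.
have cv := xiP _ (bernstein_powR_cvg M0 nu01 opnormA).
have {}cv : 2 * poly_form dotX A (bernstein_powR M nu n) p w @[n --> \oo] --> 2 * dotX xi w.
  apply: cvgMr; apply: (cvg_comp _ (dotX^~ w) cv).
  exact: dot_continuous.
apply: (cvgr_to_le cv); near=> n.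
exact: (bernstein_powR_form_le hilbX M0 Alin Asym Apos AleM Asqr n p w nu_range mu0 e0).
Unshelve. all: by end_near. Qed.

(** Optimises the free parameters of [op_powR_young]. Accepting the constant |p|^2 + 1 instead of a
    multiple of |p| lets [mu] be chosen without regard to [p]. *)
Lemma op_powR_interpolation (p w : X) :
  dotX (op_powR A nu p) w <= (`|p| ^+ 2 + 1) * (`|K w| `^ (2 * nu) * `|w| `^ (1 - 2 * nu)).
Proof.
have [nu0 nu1] := andP nu_range.
set xi := op_powR _ _ _.
have [->|wn0] := eqVneq w 0.
  by rewrite dot0r !mulr_ge0 ?powR_ge0 // addr_ge0 ?sqr_ge0.
have w0 : 0 < `|w| by rewrite normr_gt0.
have nn0 : 2 * nu != 0 by rewrite mulf_neq0 // gt_eqF.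
have [r0|rn0] := eqVneq `|K w| 0.
  rewrite r0 powR0 // mul0r mulr0.
  apply/ler_addgt0Pr => d d0; rewrite add0r.
  set c := `|p| ^+ 2 + `|w| ^+ 2 + 1.
  have c0 : 0 < c by rewrite ltr_wpDl // addr_ge0 // sqr_ge0.
  (* For [K w = 0] there is no best [e]; with [e] = mu^(1/nu) the whole right-hand side is of order
     [mu], hence arbitrarily small. *)
  pose mu := d / c; have mu0 : 0 < mu by rewrite divr_gt0.
  have := op_powR_young p w mu0 (powR_gt0 nu^-1 mu0).
  have -> : (mu `^ nu^-1) `^ (2 * nu) = mu ^+ 2.
    by rewrite -powRrM (mulrC 2) mulrA mulVf ?gt_eqF // mul1r powR_mulrn // ltW.
  rewrite r0 expr0n mulr0 add0r -/xi.
  rewrite [X in _ <= _ + X](_ : _ = (1 - 2 * nu) * (mu * `|w| ^+ 2)); last first.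
    by field; rewrite gt_eqF.
  have h1 : mu * c = d by rewrite divfK // gt_eqF.
  have h2 : 0 <= mu * `|w| ^+ 2 by rewrite mulr_ge0 ?sqr_ge0 // ltW.
  have : mu * c = mu * `|p| ^+ 2 + mu * `|w| ^+ 2 + mu by rewrite /c; ring.
  have h3 : (1 - 2 * nu) * (mu * `|w| ^+ 2) <= mu * `|w| ^+ 2.
    by rewrite ler_piMl // gerBl mulr_ge0 // ltW.
  have h4 : 0 <= mu * `|p| ^+ 2 by rewrite mulr_ge0 ?sqr_ge0 // ltW.
  rewrite h1 => h5 h6.
  have : 2 * dotX xi w <= d.
    by apply: le_trans h6 _; rewrite h5 -[leRHS]addrA lerD2l ler_wpDr // ltW.
  move: (dotX xi w) => z hz; lra.
have r0 : 0 < `|K w| by rewrite lt_neqAle eq_sym rn0 normr_ge0.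
set r := `|K w| in r0 *; set E := `|w| in w0 *.
(* With this [mu] and [e] = r^2 / E^2 the bracket becomes [mu ^+ 2] with weights [2 * nu] and
   [1 - 2 * nu], so both terms on the right are multiples of [mu]. *)
set mu := r `^ (2 * nu) * E `^ (1 - 2 * nu).
have mu0 : 0 < mu by rewrite mulr_gt0 // powR_gt0.
pose e := r ^+ 2 / E ^+ 2; have e0 : 0 < e by rewrite divr_gt0 // exprn_gt0.
have := op_powR_young p w mu0 e0; rewrite -/xi -/r -/E.
have hmu : mu ^+ 2 = e `^ (2 * nu) * E ^+ 2.
  have sq (x : R) : 0 <= x -> (x ^+ 2) `^ (2 * nu) = (x `^ (2 * nu)) ^+ 2.
    by move=> x0; rewrite -[x ^+ 2]powR_mulrn // powRAC powR_mulrn // powR_ge0.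
  have Ea0 : E `^ (2 * nu) != 0 by rewrite gt_eqF // powR_gt0.
  have ea : e `^ (2 * nu) * (E `^ (2 * nu)) ^+ 2 = (r `^ (2 * nu)) ^+ 2.
    rewrite -!sq ?(ltW r0) ?(ltW w0) // -powRM ?sqr_ge0 ?(ltW e0) //.
    by rewrite divfK // expf_neq0 // gt_eqF.
  have -> : mu = r `^ (2 * nu) * (E / E `^ (2 * nu)).
    rewrite /mu powRB; last by apply/implyP => _; rewrite gt_eqF.
    by rewrite powRr1 // ltW.
  move: Ea0 ea; set F := E `^ (2 * nu); set G := e `^ (2 * nu) => Ea0 ea.
  by rewrite exprMn -ea; field.
have hmu2 : e `^ (2 * nu - 1) * r ^+ 2 = mu ^+ 2.
  rewrite hmu powRB ?powRr1 ?(ltW e0) //; last by apply/implyP => _; rewrite gt_eqF.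
  by rewrite /e; field; rewrite !gt_eqF.
rewrite -(mulrA (2 * nu)) hmu2 -(mulrA (1 - 2 * nu)) -hmu.
rewrite [X in _ <= _ + X](_ : _ = mu); last by field; rewrite gt_eqF.
have : 0 <= mu * `|p| ^+ 2 by rewrite mulr_ge0 ?sqr_ge0 // ltW.
rewrite (mulrC _ mu) mulrDr mulr1; set z := mu * _; lra.
Qed.

End source_interpolation.

(** * The penalty and the variational inequality *)

Section penalty.
Context {R : realType} {X : completeNormedModType R} (dot : {dot X for idfun}).
Hypothesis hilb : norm_of_dot dot.
Variable phi : nat -> X.
Hypothesis basis : orthonormal_basis dot phi.
Variable q : R.
Hypothesis q_range : 1 <= q < 2.
Local Notation J := (lq_penalty dot phi q).
Local Notation proj := (proj dot phi).
Implicit Types (u v w xi : X) (s : seq nat).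

Let q0 : 0 < q.
Proof. by have [q1 _] := andP q_range; exact: lt_le_trans q1. Qed.

Lemma lq_penalty_ge0 u : (0 <= J u)%E.
Proof. by apply: nneseries_ge0 => n _ _; rewrite lee_fin powR_ge0. Qed.

Lemma lq_penalty_convex t u v : 0 <= t <= 1 ->
  (J (t *: u + (1 - t) *: v)%R <= t%:E * J u + (1 - t)%:E * J v)%E.
Proof.
move=> /andP[t0 t1]; have t1' : 0 <= 1 - t by rewrite subr_ge0.
have pE a : (0 <= (a `^ q)%:E)%E by rewrite lee_fin powR_ge0.
rewrite /lq_penalty -!nneseriesZl // -nneseriesD; last 2 first.
- by move=> i _ _; rewrite mule_ge0 ?lee_fin ?powR_ge0.
- by move=> i _ _; rewrite mule_ge0 ?lee_fin ?powR_ge0.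
apply: lee_nneseries => // i _; rewrite dotDr !dotZr -!EFinM -EFinD lee_fin.
set a := dot _ u; set b := dot _ v.
apply: (@le_trans _ _ ((t * `|a| + (1 - t) * `|b|) `^ q)).
  apply: ler_powRl => //; first exact: ltW.
  by apply: le_trans (ler_normD _ _) _; rewrite !normrM (ger0_norm t0) (ger0_norm t1').
have q1 : 1 <= q by case/andP: q_range.
have := @convex_powR R q q1 (Itv01 t0 t1) `|a| `|b|.
by rewrite !inE /= !in_itv /= !andbT !convRE /=; apply.
Qed.

Lemma lq_penalty_proj s u : uniq s -> J u = (J (proj s u) + J (u - proj s u)%R)%E.
Proof.
move=> us; rewrite /lq_penalty -nneseriesD; try by move=> i _ _; rewrite lee_fin powR_ge0.
apply: eq_eseriesr => i _; rewrite dotBr (dot_proj basis) // -EFinD.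
by case: ifP; rewrite ?subrr ?subr0 normr0 powR0 ?gt_eqF // ?addr0 ?add0r.
Qed.

(** The identity is written without subtraction because the penalty may be [+oo]. *)
Lemma lq_penalty_shift i t u :
  (J (u + t *: phi i)%R + (`|dot (phi i) u| `^ q)%:E =
   J u + (`|dot (phi i) u + t| `^ q)%:E)%E.
Proof.
have D1 (v : X) : J v = ((`|dot (phi i) v| `^ q)%:E +
    \big[+%E/0%E]_(0 <= k <oo | true && (k != i)) (`|dot (phi k) v| `^ q)%:E)%E.
  by apply: nneseriesD1 => // k _; rewrite lee_fin powR_ge0.
rewrite !D1.
have -> : \big[+%E/0%E]_(0 <= k <oo | true && (k != i)) (`|dot (phi k) (u + t *: phi i)| `^ q)%:E =
   \big[+%E/0%E]_(0 <= k <oo | true && (k != i)) (`|dot (phi k) u| `^ q)%:E.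
  apply: eq_eseriesr => k /= ki.
  by rewrite dotDr dotZr basis.1 (negbTE ki) mulr0 addr0.
rewrite dotDr dotZr basis.1 eqxx mulr1.
by rewrite addeC addeA addeAC.
Qed.

Lemma lq_penalty_partial_sum (n : nat) (x : R) u : J u = x%:E ->
  \sum_(0 <= i < n) `|dot (phi i) u| `^ q <= x.
Proof.
move=> Ju; rewrite -lee_fin -Ju -sumEFin.
by apply: nneseries_lim_ge => k _ _; rewrite lee_fin powR_ge0.
Qed.

Lemma dot_limit_le u v (b : R) :
  (forall n, \sum_(0 <= i < n) dot (phi i) u * dot (phi i) v <= b) -> dot u v <= b.
Proof.
move=> h.
have cv := @cvg_proj _ _ _ hilb _ basis v.
have {}cv : dot (proj (index_iota 0 n) v) u @[n --> \oo] --> dot v u.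
  by apply: (cvg_comp _ (dot^~ u) cv); exact: dot_continuous.
rewrite dotC; apply: (cvgr_to_le cv); near=> n.
apply: le_trans (h n); rewrite /proj dot_suml le_eqVlt; apply/orP; left; apply/eqP.
by apply: eq_bigr => i _; rewrite dotZl mulrC.
Unshelve. all: by end_near. Qed.

(** The l^2 norm is at most the l^q norm for [q <= 2]: after division by the norm of the projection
    every coordinate is at most 1 in modulus, so its square is at most its [q]-th power. *)
Lemma norm_powR_le_penalty (x : R) v : J v = x%:E -> `|v| `^ q <= x.
Proof.
move=> Jv.
have h n : `|proj (index_iota 0 n) v| `^ q <= x.
  have un : uniq (index_iota 0 n) := iota_uniq _ _.
  set m := `|_|; have [->|mn0] := eqVneq m 0.
    by rewrite powR0 ?gt_eqF // -lee_fin -Jv lq_penalty_ge0.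
  have m0 : 0 < m by rewrite lt_neqAle eq_sym mn0 normr_ge0.
  have m2 : m ^+ 2 = \sum_(0 <= i < n) dot (phi i) v ^+ 2.
    exact: (norm_orthonormal_sum hilb basis).
  apply: le_trans (lq_penalty_partial_sum n Jv).
  have mq : 0 < m `^ q by rewrite powR_gt0.
  rewrite -[leLHS]mul1r -ler_pdivlMr // mulr_suml.
  have -> : 1 = \sum_(0 <= i < n) (dot (phi i) v / m) ^+ 2.
    under eq_bigr do rewrite expr_div_n.
    by rewrite -mulr_suml -m2 divff // expf_neq0.
  rewrite big_seq [leRHS]big_seq; apply: ler_sum => i iN.
  have a1 : `|dot (phi i) v| / m <= 1.
    rewrite ler_pdivrMr // mul1r -(@ler_pXn2r _ 2) ?nnegrE ?(ltW m0) //.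
    rewrite m2 real_normK ?num_real // (bigD1_seq i) //= lerDl.
    by apply: sumr_ge0 => j _; exact: sqr_ge0.
  have -> : `|dot (phi i) v| `^ q / m `^ q = (`|dot (phi i) v| / m) `^ q.
    by rewrite powRM ?invr_ge0 ?(ltW m0) // -[m^-1]powR_inv1 ?(ltW m0) // powRAC powR_inv1 // ltW.
  have -> : (dot (phi i) v / m) ^+ 2 = (`|dot (phi i) v| / m) ^+ 2.
    by rewrite !expr_div_n real_normK ?num_real.
  set a := _ / m in a1 *.
  have : 0 <= a by rewrite divr_ge0 // ltW.
  rewrite le_eqVlt => /predU1P[<-|a0]; first by rewrite expr0n powR_ge0.
  rewrite -powR_mulrn ?(ltW a0) // ger_powR ?a0 //.
  by case/andP: q_range => _ /ltW.
have h2 n : `|proj (index_iota 0 n) v| <= x `^ q^-1.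
  apply: le_trans (ler_powRl _ _ (h n)); rewrite ?invr_ge0 ?(ltW q0) ?powR_ge0 //.
  by rewrite -powRrM divff ?gt_eqF // powRr1.
have cv := @cvg_proj _ _ _ hilb _ basis v.
have hv : `|v| <= x `^ q^-1.
  by apply: (cvgr_to_le (cvg_norm cv)); near=> n; exact: h2.
apply: le_trans (ler_powRl (ltW q0) _ hv) _ => //.
by rewrite -powRrM mulVf ?gt_eqF // powRr1 // -lee_fin -Jv lq_penalty_ge0.
Unshelve. all: by end_near. Qed.

End penalty.

(** * Coordinates of a subgradient and the Bregman lower bound *)

Section subgradient.
Context {R : realType} {X : completeNormedModType R} (dot : {dot X for idfun}).
Hypothesis hilb : norm_of_dot dot.
Variable phi : nat -> X.
Hypothesis basis : orthonormal_basis dot phi.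
Variable q : R.
Hypothesis q_range : 1 <= q < 2.
Local Notation J := (lq_penalty dot phi q).
Variables (udag xi : X).
Hypothesis xi_sub : subdifferential dot J udag xi.

Let q0 : 0 < q.
Proof. by have [q1 _] := andP q_range; exact: lt_le_trans q1. Qed.

Lemma subgradient_coord i t :
  t * dot (phi i) xi <= `|dot (phi i) udag + t| `^ q - `|dot (phi i) udag| `^ q.
Proof.
have [Jfin /(_ (udag + t *: phi i))] := xi_sub.
have := lq_penalty_shift basis q i t udag.
have : J udag \is a fin_num by rewrite ge0_fin_numE // lq_penalty_ge0.
move=> /fineK <-; rewrite addrAC subrr add0r dotZr (dotC _ xi).
case: (J (udag + t *: phi i)) => [y| |] //; rewrite -!EFinD ?lee_fin => -[].
set j := fine _; set a := `|_| `^ q; set b := `|_| `^ q; lra.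
Qed.

Lemma subgradient_eq0 i : 1 < q -> dot (phi i) udag = 0 -> dot (phi i) xi = 0.
Proof.
move=> q1 ui0; set c := dot (phi i) xi.
have h t : t * c <= `|t| `^ q.
  by have := subgradient_coord i t; rewrite ui0 add0r normr0 powR0 ?gt_eqF // subr0.
have {}h t : 0 < t -> `|c| <= t `^ (q - 1).
  move=> t0; rewrite -(ler_pM2l t0) mulr_powRB1 ?(ltW t0) //.
  have := h t; have := h (- t); rewrite normrN (gtr0_norm t0) => h1 h2.
  by have [c0|c0] := ger0P c => //; rewrite mulrN -mulNr.
apply/eqP; rewrite -normr_le0 leNgt; apply/negP => c0.
(* At this [t] the bound t^(q-1) equals |c| / 2, contradicting |c| > 0. *)
have := h ((`|c| / 2) `^ (q - 1)^-1) (powR_gt0 _ (divr_gt0 c0 (ltr0Sn R 1))).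
rewrite -powRrM mulVf ?gt_eqF ?subr_gt0 // powRr1 ?divr_ge0 //; lra.
Qed.

Lemma subgradient_le1 i : q = 1 -> `|dot (phi i) xi| <= 1.
Proof.
move=> q1; set c := dot (phi i) xi; set a := dot (phi i) udag.
have h t : t * c <= `|t|.
  have := subgradient_coord i t; rewrite q1 !powRr1 //.
  by have := ler_normD a t; rewrite -/a -/c; lra.
have := h 1; have := h (-1); rewrite normrN normr1 ler_norml; lra.
Qed.

Lemma subgradient_eq1 i : q = 1 -> dot (phi i) udag != 0 -> `|dot (phi i) xi| = 1.
Proof.
move=> q1 a0; apply/eqP; rewrite eq_le subgradient_le1 //=.
have := subgradient_coord i (- dot (phi i) udag); rewrite subrr normr0 q1 powR0 ?oner_eq0 // powRr1 //.
rewrite sub0r mulNr lerN2 => h.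
have a1 : 0 < `|dot (phi i) udag| by rewrite normr_gt0.
by rewrite -(ler_pM2l a1) mulr1 -normrM (le_trans h) // ler_norm.
Qed.

Lemma coord_small (e : R) : 0 < e -> exists N, forall i, (N <= i)%N -> `|dot (phi i) xi| < e.
Proof.
move=> e0; have /cvgrPdist_lt /(_ e e0) [N _ /(_ N (leqnn N))] := @cvg_proj _ _ _ hilb _ basis xi.
move=> /= h; exists N => i Ni; apply: le_lt_trans h.
have -> : dot (phi i) xi = dot (phi i) (xi - proj dot phi (index_iota 0 N) xi).
  by rewrite dotBr (dot_proj basis) ?iota_uniq // mem_index_iota /= ltnNge Ni subr0.
have nphi : `|phi i| = 1.
  by apply/eqP; rewrite -(@eqrXn2 _ 2) // hilb basis.1 eqxx expr1n.
by apply: le_trans (cauchy_schwarz hilb _ _) _; rewrite nphi mul1r.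
Qed.

(** For [q > 1], [I] is the support: there |t|^q is flat at 0, so [xi] vanishes off [I] and <xi, v>
    = 0. For [q = 1], [I] is the set where |xi_i| = 1; it is finite because coordinates tend to 0,
    contains the support, and off it |xi_i| stays below some [th < 1]. *)
Lemma bregman_lower_bound (Y : lmodType R) (K : {linear X -> Y}) :
  finite_set (supp dot phi udag) ->
  (1 < q -> set_inj (lspan phi (supp dot phi udag)) K) ->
  (q = 1 -> set_inj (lspan phi [set i | `|dot (phi i) xi| = 1]) K) ->
  exists (I : seq nat) (c : R), [/\ uniq I, 0 < c,
    forall i, i \notin I -> dot (phi i) udag = 0,
    forall z, lspan phi [set` I] z -> K z = 0 -> z = 0 &
    forall v x, (forall i, i \in I -> dot (phi i) v = 0) -> J v = x%:E ->
      c * `|v| `^ q <= x - dot xi v].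
Proof.
move=> fin inj1 inj2.
have inj0 (S : set nat) z : set_inj (lspan phi S) K -> lspan phi S z -> K z = 0 -> z = 0.
  move=> inj Sz Kz; apply: inj; rewrite ?inE ?linear0 //.
  by exists [::], (fun=> 0); rewrite big_nil.
have [q1 q2] := andP q_range.
move: q1; rewrite le_eqVlt => /predU1P[/esym q1|q1].
  have [N HN] := coord_small (ltr01 : 0 < 1 :> R).
  (* The first threshold only gives values below 1. The second one bounds the infinite tail by 1/2,
     so that [th] is a finite maximum started at 1/2. *)
  have [N2 HN2] := coord_small (divr_gt0 ltr01 (ltr0Sn R 1) : 0 < 1 / 2 :> R).
  pose I := [seq i <- iota 0 N | `|dot (phi i) xi| == 1].
  have IE i : (i \in I) = (`|dot (phi i) xi| == 1).
    rewrite mem_filter mem_iota /= add0n; case: eqP => //= e.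
    by rewrite ltnNge; apply/negP => /HN; rewrite e ltxx.
  pose th := \big[Order.max/ (1 / 2 : R)]_(i <- iota 0 N2 | i \notin I) `|dot (phi i) xi|.
  have th1 : th < 1.
    apply: bigmax_lt => [|i]; first by lra.
    by rewrite IE lt_neqAle => ->; rewrite subgradient_le1.
  have hth i : i \notin I -> `|dot (phi i) xi| <= th.
    move=> iI; have [iN|Ni] := ltnP i N2.
      apply: (@Order.TotalTheory.le_bigmax_seq _ _ _ (iota 0 N2) (1 / 2) i
        (fun i => i \notin I) (fun i => `|dot (phi i) xi|)) => //.
      by rewrite mem_iota.
    by apply: le_trans (ltW (HN2 _ Ni)) _; exact: bigmax_ge_id.
  exists I, (1 - th); split => //.
  - by rewrite filter_uniq // iota_uniq.
  - by rewrite subr_gt0.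
  - move=> i; rewrite IE => xi1; apply/eqP/negPn; apply: contra xi1 => /subgradient_eq1 -> //.
  - move=> z [s [a [sI ze]]]; apply: inj0 (inj2 q1) _ => //.
    by exists s, a; split => // i /sI /=; rewrite IE => /eqP.
  - move=> v x vI Jv; rewrite mulrBl mul1r.
    have hv := norm_powR_le_penalty hilb basis q_range Jv.
    have x0 : 0 <= x := le_trans (powR_ge0 _ _) hv.
    have th0 : 0 <= th by apply: le_trans (bigmax_ge_id _ _ _ _); lra.
    have : dot xi v <= th * x.
      apply: (dot_limit_le hilb basis) => n.
      apply: le_trans (ler_wpM2l th0 (lq_penalty_partial_sum n Jv)).
      rewrite mulr_sumr; apply: ler_sum => i _; rewrite q1 powRr1 //.
      have [/vI ->|/hth h] := boolP (i \in I); first by rewrite mulr0 normr0 mulr0.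
      by apply: le_trans (ler_norm _) _; rewrite normrM ler_wpM2r.
    have th1' := ltW th1; nra.
have /finite_seqP[s sE] := fin.
have sE' i : (i \in undup s) = (dot (phi i) udag != 0).
  rewrite mem_undup; apply/idP/idP => h.
    by have : supp dot phi udag i by rewrite sE.
  by have : [set` s] i by rewrite -sE.
exists (undup s), 1; split => //.
- exact: undup_uniq.
- by move=> i; rewrite sE' negbK => /eqP.
- move=> z [s' [a [sI ze]]]; apply: inj0 (inj1 q1) _ => //.
  by exists s', a; split => // i /sI /=; rewrite sE'.
- move=> v x vI Jv; rewrite mul1r.
  have hv := norm_powR_le_penalty hilb basis q_range Jv.
  suff : dot xi v <= 0 by lra.
  apply: (dot_limit_le hilb basis) => n.
  rewrite big1 // => i _; have [/vI ->|] := boolP (i \in undup s); first by rewrite mulr0.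
  by rewrite sE' negbK => /eqP /(subgradient_eq0 q1) ->; rewrite mul0r.
Qed.

End subgradient.

(* Coordinates are recovered from K z by inverting the Gram matrix of the K phi_i. *)
Lemma coercive_on_span {R : realType} {X H : completeNormedModType R}
    (dotX : {dot X for idfun}) (dotH : {dot H for idfun})
    (hilbX : norm_of_dot dotX) (hilbH : norm_of_dot dotH)
    (phi : nat -> X) (basis : orthonormal_basis dotX phi)
    (K : {linear X -> H}) (I : seq nat) :
  uniq I -> (forall z, lspan phi [set` I] z -> K z = 0 -> z = 0) ->
  exists2 c : R, 0 < c & forall w, `|proj dotX phi I w| <= c * `|K (proj dotX phi I w)|.
Proof.
move=> uI inj; pose n := size I; pose f (i : 'I_n) := phi (nth 0%N I i).
have sumE (G : nat -> X) : \sum_(i <- I) G i = \sum_(i < n) G (nth 0%N I i).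
  by rewrite (big_nth 0%N) big_mkord.
pose G : 'M[R]_n := \matrix_(i, j) dotH (K (f i)) (K (f j)).
have mulG (a : 'I_n -> R) j :
    ((\row_i a i) *m G) 0 j = dotH (K (\sum_(i < n) a i *: f i)) (K (f j)).
  rewrite linear_sum dot_suml mxE; apply: eq_bigr => i _.
  by rewrite !mxE linearZ dotZl.
have Gu : G \in unitmx.
  rewrite -row_free_unit -kermx_eq0; apply/eqP/row_matrixP => k0.
  rewrite row0; set r := row k0 _; have rG : r *m G = 0.
    by apply/eqP; rewrite -row_mul mulmx_ker row0.
  pose a i := r 0 i; have ra : r = \row_i a i by apply/rowP => i; rewrite mxE.
  pose z := \sum_(i < n) a i *: f i.
  have Kz : K z = 0.
    apply/eqP; rewrite -normr_eq0 -sqrf_eq0 hilbH {2}/z linear_sum dot_sumr big1 // => j _.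
    by rewrite linearZ dotZr -linear_sum -mulG -ra rG mxE mulr0.
  pose b (i : nat) := if insub (index i I) is Some j then a j else 0.
  have zE : z = \sum_(i <- I) b i *: phi i.
    rewrite sumE /z; apply: eq_bigr => i _; rewrite /b index_uniq //.
    by rewrite valK.
  have z0 : z = 0.
    apply: inj Kz; exists I, b; split => //.
  apply/rowP => j; rewrite [RHS]mxE.
  have : dotX (phi (nth 0%N I j)) z = b (nth 0%N I j).
    by rewrite zE (dot_orthonormal_sum basis) // mem_nth.
  by rewrite z0 dot0r /b index_uniq // valK => /esym.
pose c := \sum_(j < n) \sum_(i < n) `|K (f i)| * `|invmx G i j|.
have c0 : 0 <= c by apply: sumr_ge0 => j _; apply: sumr_ge0 => i _; rewrite mulr_ge0.
exists (c + 1) => [|w]; first by rewrite ltr_wpDl.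
set z := proj _ _ _ _.
apply: (@le_trans _ _ (c * `|K z|)); last by rewrite ler_wpM2r // lerDl.
pose a i := dotX (f i) w.
have zE : z = \sum_(i < n) a i *: f i by rewrite /z /proj sumE.
have nf i : `|f i| = 1.
  by apply/eqP; rewrite -(@eqrXn2 _ 2) // hilbX basis.1 eqxx expr1n.
rewrite {1}zE; apply: le_trans (ler_norm_sum _ _ _) _.
rewrite /c mulr_suml; apply: ler_sum => j _; rewrite normrZ nf mulr1.
have -> : a j = ((\row_i a i) *m G *m invmx G) 0 j by rewrite mulmxK // mxE.
rewrite mxE mulr_suml; apply: le_trans (ler_norm_sum _ _ _) _; apply: ler_sum => i _.
rewrite normrM mulG -zE [leRHS]mulrAC ler_wpM2r // mulrC.
exact: cauchy_schwarz.
Qed.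

(** Origin of the exponent al = q nu / (q - 1 + 2 nu): the weight [th] is fixed by q (1 - th) = 1 -
    2 nu, and then the power of [r] has to be 2 nu / th. *)
Lemma interpolation_young (R : realType) (q nu B d : R) :
  1 <= q -> 0 < nu <= 1 / 2 -> 0 <= B -> 0 < d ->
  exists2 L : R, 0 < L & forall r e : R, 0 <= r -> 0 <= e ->
    B * (r `^ (2 * nu) * e `^ (1 - 2 * nu)) <=
    d * e `^ q + L * r `^ (2 * (q * nu / (q - 1 + 2 * nu))).
Proof.
move=> q1 /andP[nu0 nu1] B0 d0.
have q0 : 0 < q := lt_le_trans ltr01 q1.
have m0 : 0 < q - 1 + 2 * nu by rewrite ltr_wpDl ?subr_ge0 // mulr_gt0.
pose th := (q - 1 + 2 * nu) / q.
have th0 : 0 < th by rewrite divr_gt0.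
have th1 : th <= 1 by rewrite ler_pdivrMr // mul1r; lra.
(* Solves L^th d^(1 - th) = B + 1; the added 1 keeps [L] positive when [B = 0]. *)
pose L := ((B + 1) / d `^ (1 - th)) `^ th^-1.
have B1 : 0 < B + 1 by rewrite ltr_wpDl.
have dt0 : 0 < d `^ (1 - th) by rewrite powR_gt0.
have L0 : 0 < L by rewrite powR_gt0 // divr_gt0.
exists L => // r e r0 e0; set al := 2 * (q * nu / _).
have := @powR_young R th (L * r `^ al) (d * e `^ q).
rewrite (ltW th0) th1 !mulr_ge0 ?(ltW L0) ?(ltW d0) ?powR_ge0 // => /(_ isT isT isT).
rewrite !powRM ?powR_ge0 ?(ltW L0) ?(ltW d0) // -!powRrM mulVf ?gt_eqF //.
rewrite powRr1 ?divr_ge0 ?(ltW B1) ?(ltW dt0) //.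
have -> : al * th = 2 * nu by rewrite /al /th; field; rewrite !gt_eqF.
have -> : q * (1 - th) = 1 - 2 * nu by rewrite /th; field; rewrite gt_eqF.
set z1 := r `^ _; set z2 := e `^ _; set x := r `^ al; set y := e `^ q.
rewrite [X in X <= _ -> _](_ : _ = (B + 1) * (z1 * z2)); last by field; rewrite gt_eqF.
have z0 : 0 <= z1 * z2 by rewrite mulr_ge0 ?powR_ge0.
have x0 : 0 <= L * x by rewrite mulr_ge0 ?powR_ge0 ?(ltW L0).
have y0 : 0 <= d * y by rewrite mulr_ge0 ?powR_ge0 ?(ltW d0).
have hx : th * (L * x) <= L * x by rewrite ler_piMl.
have hy : (1 - th) * (d * y) <= d * y by rewrite ler_piMl // gerBl ltW.
move=> h; rewrite addrC; apply: (le_trans _ (lerD hx hy)); apply: le_trans h.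
by rewrite mulrDl mul1r lerDl.
Qed.

(** * The variational inequality *)

Section variational_inequality.
Context {R : realType} {X H : completeNormedModType R}.
Variables (dotX : {dot X for idfun}) (dotH : {dot H for idfun}).
Hypotheses (hilbX : norm_of_dot dotX) (hilbH : norm_of_dot dotH).
Variables (phi : nat -> X) (basis : orthonormal_basis dotX phi).

Lemma proj_id (I : seq nat) (u : X) : uniq I ->
  (forall i, i \notin I -> dotX (phi i) u = 0) -> proj dotX phi I u = u.
Proof.
move=> uI uI0; apply/esym/eqP; rewrite -subr_eq0 -normr_eq0 -sqrf_eq0 eq_le sqr_ge0 andbT.
rewrite hilbX; apply: (dot_limit_le hilbX basis) => n; rewrite big1 // => i _.
rewrite dotBr (dot_proj basis) //; case: ifPn => [_|/uI0 ->].
  by rewrite subrr mulr0.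
by rewrite subrr mulr0.
Qed.

Variables (K : {linear X -> H}) (K_bounded : continuous K).
Variables (q : R) (q_range : 1 <= q < 2).
Local Notation J := (lq_penalty dotX phi q).
Variables (g : H) (udag : X) (Kudag : K udag = g).
Variables (nu : R) (nu_range : 0 < nu <= 1 / 2) (pdag xidag : X).
Hypothesis source : op_powR (fun x => adjoint dotX dotH K (K x)) nu pdag = xidag.
Hypothesis xidag_sub : subdifferential dotX J udag xidag.
Hypothesis supp_finite : finite_set (supp dotX phi udag).
Hypothesis inj_q_gt1 : 1 < q -> set_inj (lspan phi (supp dotX phi udag)) K.
Hypothesis inj_q_eq1 : q = 1 ->
  set_inj (lspan phi [set i | `|dotX (phi i) xidag| = 1]) K.

Lemma penalty_split_fin (s : seq nat) (u : X) (y : R) : uniq s -> J u = y%:E ->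
  exists y1 y2 : R, [/\ J (proj dotX phi s u) = y1%:E,
    J (u - proj dotX phi s u) = y2%:E & y = y1 + y2].
Proof.
move=> us Ju; have := lq_penalty_proj basis q_range u us; rewrite Ju.
have := lq_penalty_ge0 dotX phi q (proj dotX phi s u).
have := lq_penalty_ge0 dotX phi q (u - proj dotX phi s u).
case: (J (proj _ _ _ _)) => [y1| |] //; case: (J (_ - _)) => [y2| |] // _ _ [->].
by exists y1, y2.
Qed.

Lemma variational_inequality : exists C c : R, [/\ 0 < C, 0 < c &
  forall (u : X) (y y0 : R), J u = y%:E -> J udag = y0%:E ->
    C * `|udag - u| `^ q <=
    y - y0 + powsum c (q * nu / (q - 1 + 2 * nu)) (q / 2) (`|K u - g| ^+ 2)].
Proof.
have [q1 q2] := andP q_range; have q0 : 0 < q := lt_le_trans ltr01 q1.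
have [I [c0 [uI c00 suppI injI breg]]] :=
  bregman_lower_bound hilbX basis q_range xidag_sub supp_finite inj_q_gt1 inj_q_eq1.
have [c1 c10 coer] := coercive_on_span hilbX hilbH basis uI injI.
have [k k0 Kk] : exists2 k : R, 0 < k & forall x, `|K x| <= k * `|x|.
  have /linear_boundedP h := continuous_linear_bounded 0 (K_bounded (x:=0)).
  near +oo_R => k; exists k; first by near: k; exact: nbhs_pinfty_gt.
  by near: k.
(* Constant of |w| <= c2 (|K w| + |b|): [w - b] lies in the span of [I], where |w - b| <= c1 |K (w -
   b)| <= c1 (|K w| + k |b|). *)
pose c2 := c1 + c1 * k + 1.
have c20 : 0 < c2 by rewrite ltr_wpDl // addr_ge0 ?mulr_ge0 ?(ltW c10) ?(ltW k0).
pose c3 := c2 `^ q * 2 `^ q.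
have c30 : 0 < c3 by rewrite mulr_gt0 // powR_gt0.
pose B := `|pdag| ^+ 2 + 1.
have B0 : 0 <= B by rewrite addr_ge0 // sqr_ge0.
(* Of the available (c0 / c3) |w|^q one half is spent on Young's inequality; the other half is the
   final constant. *)
have d0 : 0 < c0 / (2 * c3) by rewrite divr_gt0 // mulr_gt0.
have [L L0 young] := interpolation_young q1 nu_range B0 d0.
exists (c0 / (2 * c3)), (c0 + L); split => //; first exact: addr_gt0.
move=> u y y0 Ju Judag.
rewrite distrC; set w := u - udag; set e := `|w|.
have KwE : K u - g = K w by rewrite -Kudag linearB.
rewrite KwE; set r := `|K w|.
have e0 : 0 <= e := normr_ge0 _.
have r0 : 0 <= r := normr_ge0 _.
have [y1 [y2 [Jy1 Jy2 yE]]] := penalty_split_fin uI Ju.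
set b := u - proj dotX phi I u in Jy2.
have wE : proj dotX phi I w = w - b.
  rewrite projB (proj_id uI suppI) /w /b; set z := proj _ _ _ _.
  by rewrite opprB [RHS]addrC addrA subrK.
have hb : c0 * `|b| `^ q <= y2 - dotX xidag b.
  apply: breg Jy2 => i iI.
  by rewrite /b dotBr (dot_proj basis) // iI subrr.
have hs : y0 + dotX xidag (proj dotX phi I u - udag) <= y1.
  have [_ /(_ (proj dotX phi I u))] := xidag_sub.
  by rewrite Judag Jy1 -EFinD lee_fin.
have hw : dotX xidag (proj dotX phi I u - udag) + dotX xidag b = dotX xidag w.
  by rewrite -dotDr /b addrC addrA subrK.
have hxi : - dotX xidag w <= B * (r `^ (2 * nu) * e `^ (1 - 2 * nu)).
  have := op_powR_interpolation hilbX hilbH basis (ltW k0) Kk nu_range pdag (- w).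
  by rewrite source dotNr linearN !normrN.
(* Adds the lower bound at [b], the subgradient inequality at the projection of [u], and the source
   bound at [- w]; the terms with [xidag] combine to <xidag, w>. *)
have {}hb : c0 * `|b| `^ q <= y - y0 + B * (r `^ (2 * nu) * e `^ (1 - 2 * nu)).
  move: hb hs hw hxi; rewrite yE; set B1 := B * _; lra.
have heb : e <= c2 * (r + `|b|).
  have : e <= `|w - b| + `|b| by rewrite /e -{1}(subrK b w) ler_normD.
  have : `|w - b| <= c1 * (r + k * `|b|).
    rewrite -wE; apply: le_trans (coer w) _; rewrite ler_wpM2l ?(ltW c10) //.
    rewrite wE linearB; apply: le_trans (ler_normB _ _) _.
    by rewrite lerD2l.
  have b0 : 0 <= `|b| := normr_ge0 _.
  have : 0 <= c1 * k * r + r + c1 * `|b|.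
    by rewrite !addr_ge0 // !mulr_ge0 // ltW.
  rewrite /c2 mulrDr; lra.
have heq : e `^ q <= c3 * (r `^ q + `|b| `^ q).
  apply: le_trans (ler_powRl (ltW q0) e0 heb) _.
  rewrite powRM ?(ltW c20) ?addr_ge0 // /c3 -mulrA ler_wpM2l ?powR_ge0 //.
  by apply: powR_addr_le => //; exact: ltW.
have := young r e r0 e0; set al := q * nu / _.
rewrite /powsum !powR_sqr // -/r -/e.
have -> : 2 * (q / 2) = q by field.
move: hb heq; set z1 := r `^ q; set z2 := r `^ (2 * al); set E := e `^ q.
set Bz := B * _; set bq := `|b| `^ q; set D := y - y0 => hb heq hy.
have z10 : 0 <= z1 := powR_ge0 _ _; have z20 : 0 <= z2 := powR_ge0 _ _.
have h1 : c0 / c3 * E <= c0 * z1 + c0 * bq.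
  rewrite -mulrDr mulrAC -mulrA ler_wpM2l ?(ltW c00) // ler_pdivrMr //.
  by rewrite mulrC.
have h2 : c0 / c3 * E = c0 / (2 * c3) * E + c0 / (2 * c3) * E.
  by field; rewrite gt_eqF.
have h3 : 0 <= L * z1 by rewrite mulr_ge0 // ltW.
have h4 : 0 <= c0 * z2 by rewrite mulr_ge0 // ltW.
move: hb hy h1 h2; set F := c0 / (2 * c3) * E; set F2 := c0 / c3 * E => hb hy h1 h2.
have -> : (c0 + L) * (z2 + z1) = c0 * z2 + L * z2 + c0 * z1 + L * z1 by ring.
lra.
Unshelve. all: by end_near. Qed.

End variational_inequality.

(** * The augmented Lagrangian method *)

Lemma stepsumS (R : realType) (tau : nat -> R) n :
  stepsum tau n.+1 = stepsum tau n + tau n.+1.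
Proof. by rewrite /stepsum big_nat_recr. Qed.

Lemma stepsum0 (R : realType) (tau : nat -> R) : stepsum tau 0 = 0.
Proof. by rewrite /stepsum big_geq. Qed.

Lemma norm_sqr_axpy {R : realType} {H : completeNormedModType R} (dot : {dot H for idfun}) :
  norm_of_dot dot -> forall (a b : H) (s : R),
  `|a + s *: b| ^+ 2 = `|a| ^+ 2 + 2 * (s * dot a b) + s ^+ 2 * `|b| ^+ 2.
Proof.
by move=> hilb a b s; rewrite !hilb !(dotDl, dotDr, dotZl, dotZr) (dotC dot b a); ring.
Qed.

Section augmented_lagrangian.
Context {R : realType} {X H : completeNormedModType R} (dot : {dot H for idfun}).
Hypothesis hilb : norm_of_dot dot.
Variable K : {linear X -> H}.
Variable J : X -> \bar R.
Hypothesis J_ge0 : forall u, (0 <= J u)%E.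
Hypothesis J_convex : forall t u v, 0 <= t <= 1 ->
  (J (t *: u + (1 - t) *: v)%R <= t%:E * J u + (1 - t)%:E * J v)%E.
Variables (udag : X) (y0 : R) (g : H).
Hypothesis Jdag : J udag = y0%:E.
Hypothesis Kdag : K udag = g.
Variables (tau : nat -> R) (gd p0 : H) (u : nat -> X) (p : nat -> H).
Hypothesis tau_gt0 : forall k, (1 <= k)%N -> 0 < tau k.
Hypothesis alm : alm_iterates dot K J tau gd p0 u p.

Local Notation t := (stepsum tau).

Definition residual k := K (u k) - gd.
Local Notation r := residual.

Definition penalty_value k : R := fine (J (u k)).
Local Notation j := penalty_value.

Lemma penalty_convex_fin (s : R) v w x y : 0 <= s <= 1 -> J v = x%:E -> J w = y%:E ->
  exists2 z, J (s *: v + (1 - s) *: w) = z%:E & z <= s * x + (1 - s) * y.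
Proof.
move=> s01 Jv Jw; have := J_convex v w s01; have := J_ge0 (s *: v + (1 - s) *: w).
rewrite Jv Jw; case: (J _) => [z| |] // _; rewrite -!EFinM -EFinD lee_fin => h.
by exists z.
Qed.

Lemma alm_penalty_fin k : J (u k.+1) = (j k.+1)%:E.
Proof.
have := (alm.2 k).1 udag; rewrite /alm_objective Jdag.
by rewrite /penalty_value; have := J_ge0 (u k.+1); case: (J (u k.+1)).
Qed.

Lemma alm_dualE k : p k.+1 = p k - tau k.+1 *: r k.+1.
Proof. by rewrite (alm.2 k).2 /residual -scalerN opprB. Qed.

(* The first-order condition K^* p_k \in \partial J(u_k), without the adjoint. *)
Lemma alm_optimality k v y : J v = y%:E ->
  j k.+1 + dot (p k.+1) (K v - K (u k.+1)) <= y.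
Proof.
move=> Jv; set d := K v - K (u k.+1).
have tau0 : 0 < tau k.+1 by exact: tau_gt0.
set A := y - j k.+1 - dot (p k.+1) d; set B := tau k.+1 / 2 * `|d| ^+ 2.
have B0 : 0 <= B by rewrite mulr_ge0 ?sqr_ge0 // divr_ge0 // ltW.
suff : 0 <= A by rewrite /A; lra.
(* The minimiser is compared with a point of the segment towards [v], and the result is divided by
   [s]. *)
have key s : 0 < s -> s <= 1 -> 0 <= A + s * B.
  move=> s0 s1; have s01 : 0 <= s <= 1 by rewrite ltW.
  have [z Jz hz] := penalty_convex_fin s01 Jv (alm_penalty_fin k).
  have : tau k.+1 / 2 * `|r k.+1| ^+ 2 + j k.+1 - dot (p k) (r k.+1) <=
      tau k.+1 / 2 * `|K (s *: v + (1 - s) *: u k.+1) - gd| ^+ 2 + z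
      - dot (p k) (K (s *: v + (1 - s) *: u k.+1) - gd).
    have := (alm.2 k).1 (s *: v + (1 - s) *: u k.+1).
    by rewrite /alm_objective alm_penalty_fin Jz -lee_fin.
  have -> : K (s *: v + (1 - s) *: u k.+1) - gd = r k.+1 + s *: d.
    rewrite linearD !linearZ /= /residual /d scalerBl scale1r scalerBr.
    by rewrite addrCA addrAC.
  rewrite (norm_sqr_axpy hilb) /A /B alm_dualE; clearbody d; move: (r k.+1) => rr h.
  have : 0 <= s * (y - j k.+1 - (dot (p k) d - tau k.+1 * dot rr d) + s * (tau k.+1 / 2 * `|d| ^+ 2)).
    move: h hz; rewrite dotDr dotZr.
    set N := `|rr| ^+ 2; set dd := `|d| ^+ 2; set rd := dot rr d; set pd := dot _ d; set pr := dot _ rr.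
    rewrite -subr_ge0 => h hz; apply: le_trans h _; rewrite -subr_ge0.
    rewrite [X in 0 <= X](_ : _ = s * y + (1 - s) * j k.+1 - z); last by field.
    by rewrite subr_ge0.
  by rewrite pmulr_rge0 // dotBl dotZl.
rewrite leNgt; apply/negP => A0.
have BA : 0 < B - A by lra.
(* If [A] were negative, this [s] would give the value - A^2 / (B - A) < 0, so no limit in [s] is
   required. *)
have := key (- A / (B - A)); rewrite divr_gt0 ?oppr_gt0 // => /(_ isT).
rewrite ler_pdivrMr // mul1r lerDr B0 => /(_ isT).
have -> : A + - A / (B - A) * B = - (A ^+ 2 / (B - A)) by field; rewrite gt_eqF.
by rewrite oppr_ge0 leNgt divr_gt0 // exprn_even_gt0 //= lt_eqF.
Qed.

(** Monotonicity of the subdifferential: testing two consecutive optimality conditions at each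
    other's iterate and adding gives <r_(k+2), r_(k+2) - r_(k+1)> <= 0. *)
Lemma alm_residual_noninc k : `|r k.+2| <= `|r k.+1|.
Proof.
have := alm_optimality k.+1 (alm_penalty_fin k).
have := alm_optimality k (alm_penalty_fin k.+1).
have e a b : K (u a) - K (u b) = r a - r b by rewrite /residual opprB addrA subrK.
rewrite !e (alm_dualE k.+1); have tau0 : 0 < tau k.+2 by exact: tau_gt0.
move: (r k.+1) (r k.+2) => r1 r2; rewrite !(dotBl, dotBr, dotZl, dotZr) => h1 h2.
have : tau k.+2 * dot r2 r2 <= tau k.+2 * dot r2 r1 by lra.
rewrite ler_pM2l // -hilb => h.
have [->|rn0] := eqVneq r2 0; first by rewrite normr0.
have r0 : 0 < `|r2| by rewrite normr_gt0.
rewrite -(ler_pM2l r0) -expr2 (le_trans h) //.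
by apply: le_trans (ler_norm _) _; exact: cauchy_schwarz.
Qed.

Lemma stepsum_ge0 n : 0 <= t n.
Proof. by elim: n => [|n IH]; rewrite ?stepsum0 // stepsumS addr_ge0 // ltW // tau_gt0. Qed.

Lemma stepsum_gt0 n : 0 < t n.+1.
Proof. by rewrite stepsumS ltr_wpDl ?tau_gt0 // stepsum_ge0. Qed.

(** For k >= 1 optimality makes this the dual objective, conjugate of [J] at the adjoint image of
    p_k minus <p_k, gd>; the method is the proximal point iteration for it. *)
Definition dual_value k := dot (p k) (r k) - j k.
Local Notation F := dual_value.

(** The weights are such that expanding |p_n|^2 around p_(n+1) cancels every term of the increment
    except those compared in [tF]: descent of the dual value and decrease of the residual. *)
Lemma alm_energy n :
  t n * F n + t n ^+ 2 * `|r n| ^+ 2 / 2 + `|p n| ^+ 2 / 2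
    + \sum_(1 <= k < n.+1) tau k * j k <= `|p0| ^+ 2 / 2.
Proof.
elim: n => [|n IH].
  by rewrite stepsum0 expr0n !mul0r !add0r big_geq // addr0 alm.1.
apply: le_trans IH; rewrite big_nat_recr //=; set S := \sum_(_ <= _ < _) _.
rewrite stepsumS.
have pE : `|p n| ^+ 2 = `|p n.+1| ^+ 2 + 2 * (tau n.+1 * dot (p n.+1) (r n.+1)) + tau n.+1 ^+ 2 * `|r n.+1| ^+ 2.
  have -> : p n = p n.+1 + tau n.+1 *: r n.+1 by rewrite alm_dualE subrK.
  exact: norm_sqr_axpy.
have tF : t n * (F n.+1 + tau n.+1 * `|r n.+1| ^+ 2) + t n ^+ 2 * `|r n.+1| ^+ 2 / 2 <=
    t n * F n + t n ^+ 2 * `|r n| ^+ 2 / 2.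
  (* The index 0 iterate carries no information, but its terms are multiplied by t_0 = 0. *)
  case: n {S pE} => [|n]; first by rewrite stepsum0 expr0n !mul0r.
  have tn0 := stepsum_ge0 n.+1.
  apply: lerD; last first.
    rewrite ler_wpM2r // ler_wpM2l ?sqr_ge0 // lerXn2r ?nnegrE ?normr_ge0 //.
    exact: alm_residual_noninc.
  apply: ler_wpM2l => //.
  have := alm_optimality n (alm_penalty_fin n.+1).
  have -> : K (u n.+2) - K (u n.+1) = r n.+2 - r n.+1 by rewrite /residual opprB addrA subrK.
  rewrite /dual_value (alm_dualE n.+1); move: (r n.+1) (r n.+2) => r1 r2.
  by rewrite hilb !(dotBr, dotBl, dotZl); lra.
rewrite pE; move: tF; rewrite /dual_value; set a := dot (p n.+1) _; set b := `|r n.+1| ^+ 2.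
set c := `|p n.+1| ^+ 2; set d := t n ^+ 2 * `|r n| ^+ 2; set f := t n * (dot (p n) _ - _).
rewrite -subr_ge0 => h; rewrite -subr_ge0; apply: le_trans h _.
by rewrite le_eqVlt; apply/orP; left; apply/eqP; field.
Qed.

Lemma alm_average n : exists v y, [/\ J v = y%:E,
  t n.+1 * y <= \sum_(1 <= k < n.+2) tau k * j k &
  t n.+1 *: (K v - gd) = p0 - p n.+1].
Proof.
elim: n => [|n [v [y [Jv yS Kv]]]].
  exists (u 1%N), (j 1%N); split; first exact: alm_penalty_fin.
    by rewrite big_nat1 stepsumS stepsum0 add0r.
  by rewrite stepsumS stepsum0 add0r alm_dualE alm.1 opprB addrCA subrr addr0.
have t1 := stepsum_gt0 n; have t2 := stepsum_gt0 n.+1.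
have tau0 : 0 < tau n.+2 by exact: tau_gt0.
have tE : t n.+2 = t n.+1 + tau n.+2 by rewrite stepsumS.
(* The average is extended by one iterate with weight t_(n+1) / t_(n+2) on the old part; convexity
   handles the penalty and the dual updates telescope. *)
have [s [s01 ts ts']] : exists s : R, [/\ 0 <= s <= 1, t n.+2 * s = t n.+1 &
    t n.+2 * (1 - s) = tau n.+2].
  exists (t n.+1 / t n.+2); rewrite mulrBr mulr1 (mulrC (t n.+2)) divfK ?gt_eqF //; split => //.
    by rewrite divr_ge0 ?(ltW t1) ?(ltW t2) //= ler_pdivrMr // mul1r tE lerDl ltW.
  by rewrite tE addrC addKr.
have [z Jz hz] := penalty_convex_fin s01 Jv (alm_penalty_fin n.+1).
exists (s *: v + (1 - s) *: u n.+2), z; split => //.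
  rewrite big_nat_recr //=; apply: le_trans (ler_wpM2l (ltW t2) hz) _.
  by rewrite mulrDr !mulrA ts ts' lerD2r.
have -> : K (s *: v + (1 - s) *: u n.+2) - gd = s *: (K v - gd) + (1 - s) *: r n.+2.
  rewrite linearD !linearZ /= /residual !scalerBr addrACA -opprD -scalerDl.
  by rewrite subrKC scale1r.
rewrite scalerDr !scalerA ts ts' Kv (alm_dualE n.+1) opprB.
by rewrite [RHS]addrA [RHS]addrAC.
Qed.

Section noise.
Variable delta : R.
Hypothesis gdelta : `|g - gd| <= delta.

(** Weak duality: [udag] fits [g] rather than [gd], which costs [delta] times the norm of the dual
    iterate. *)
Lemma alm_dual_value_ge n : - y0 - delta * `|p n.+1| <= F n.+1.
Proof.
have := alm_optimality n Jdag; rewrite Kdag.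
have -> : g - K (u n.+1) = (g - gd) - r n.+1 by rewrite /residual opprB addrA subrK.
rewrite dotBr /dual_value => h.
have : - (delta * `|p n.+1|) <= dot (p n.+1) (g - gd).
  rewrite lerNl -dotNr; apply: le_trans (ler_norm _) _.
  apply: le_trans (cauchy_schwarz hilb _ _) _.
  by rewrite mulrC normrN ler_wpM2r.
move: h; set a := dot _ _; set b := dot _ _; set c := delta * _; lra.
Qed.

(** [y] is left free: the value 0 gives the crude bound, the penalty of the averaged iterate the
    sharp one. *)
Lemma alm_energy_le n y : t n.+1 * y <= \sum_(1 <= k < n.+2) tau k * j k ->
  t n.+1 ^+ 2 * `|r n.+1| ^+ 2 + `|p n.+1| ^+ 2 <=
  `|p0| ^+ 2 + 2 * (t n.+1 * delta * `|p n.+1|) + 2 * (t n.+1 * (y0 - y)).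
Proof.
move=> hy; have := alm_energy n.+1.
have := ler_wpM2l (ltW (stepsum_gt0 n)) (alm_dual_value_ge n).
have -> : t n.+1 * (- y0 - delta * `|p n.+1|) = - (t n.+1 * y0) - t n.+1 * delta * `|p n.+1|.
  by ring.
have -> : t n.+1 * (y0 - y) = t n.+1 * y0 - t n.+1 * y by ring.
move: hy; set S := \sum_(_ <= _ < _) _; set a := _ ^+ 2 * _; set b := `|p n.+1| ^+ 2.
set tf := t _ * F _; set td := _ * delta * _; lra.
Qed.

(* Needed while t_n < 1, where the Phi term of the sharper bound blows up as t_n -> 0. *)
Lemma alm_energy_crude n :
  t n.+1 ^+ 2 * `|r n.+1| ^+ 2 + `|p n.+1| ^+ 2 <=
  `|p0| ^+ 2 + 2 * (t n.+1 * delta * `|p n.+1|) + 2 * (t n.+1 * y0).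
Proof.
have := @alm_energy_le n 0; rewrite subr0 mulr0; apply.
rewrite big_nat_cond sumr_ge0 // => -[//|k] _.
rewrite mulr_ge0 ?(ltW (tau_gt0 _)) // -lee_fin -alm_penalty_fin; exact: J_ge0.
Qed.

Variables (Phi : R -> R) (C q : R).
Hypothesis Phi_mono : forall a b, 0 <= a -> a <= b -> Phi a <= Phi b.
Hypothesis C0 : 0 <= C.
Hypothesis vi : forall v y, J v = y%:E ->
  C * `|udag - v| `^ q <= y - y0 + Phi (`|K v - g| ^+ 2).

(** At the averaged iterate the variational inequality, with its distance term dropped, bounds
    [y0 - y] by [Phi] of a misfit that the dual iterate controls. The bound stays implicit in that
    iterate and is resolved in [energy_rate]. *)
Lemma alm_energy_variational n :
  t n.+1 ^+ 2 * `|r n.+1| ^+ 2 + `|p n.+1| ^+ 2 <=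
  `|p0| ^+ 2 + 2 * (t n.+1 * delta * `|p n.+1|) +
  2 * (t n.+1 * Phi (((`|p n.+1| + `|p0|) / t n.+1 + delta) ^+ 2)).
Proof.
have t0 := stepsum_gt0 n.
have [v [y [Jv yS Kv]]] := alm_average n.
apply: le_trans (alm_energy_le yS) _.
rewrite lerD2l ler_wpM2l // ler_wpM2l ?(ltW t0) //.
have h1 : y0 - y <= Phi (`|K v - g| ^+ 2).
  have := vi Jv; have : 0 <= C * `|udag - v| `^ q by rewrite mulr_ge0 ?powR_ge0.
  set a := C * _; lra.
apply: le_trans h1 _; apply: Phi_mono; first exact: sqr_ge0.
have h2 : `|K v - gd| <= (`|p n.+1| + `|p0|) / t n.+1.
  rewrite ler_pdivlMr // mulrC -{1}(gtr0_norm t0) -normrZ Kv addrC.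
  by apply: le_trans (ler_normD _ _) _; rewrite normrN.
rewrite lerXn2r ?nnegrE ?normr_ge0 //.
  by rewrite addr_ge0 // ?divr_ge0 ?addr_ge0 ?(ltW t0) // (le_trans _ gdelta).
have -> : K v - g = (K v - gd) - (g - gd) by rewrite opprB addrA subrK.
by apply: le_trans (ler_normB _ _) _; exact: lerD.
Qed.

Lemma alm_error n : C * `|u n.+1 - udag| `^ q <=
  `|p n.+1| * (`|r n.+1| + delta) + Phi ((`|r n.+1| + delta) ^+ 2).
Proof.
rewrite distrC; apply: le_trans (vi (alm_penalty_fin n)) _.
have hr : `|K (u n.+1) - g| <= `|r n.+1| + delta.
  have -> : K (u n.+1) - g = r n.+1 - (g - gd) by rewrite /residual opprB addrA subrK.
  by apply: le_trans (ler_normB _ _) _; rewrite lerD2l.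
apply: lerD; last first.
  apply: Phi_mono; first exact: sqr_ge0.
  by rewrite lerXn2r ?nnegrE ?normr_ge0 // (le_trans _ hr).
have := alm_optimality n Jdag; rewrite Kdag => h.
have : - dot (p n.+1) (g - K (u n.+1)) <= `|p n.+1| * (`|r n.+1| + delta).
  rewrite -dotNr opprB; apply: le_trans (ler_norm _) _.
  by apply: le_trans (cauchy_schwarz hilb _ _) _; rewrite ler_wpM2l.
move: h; set a := dot _ _; set b := `|p _| * _; lra.
Qed.

End noise.

End augmented_lagrangian.

(** * From the energy bound to rates: inequalities between real numbers *)

Section rates.
Context {R : realType} (al q c : R).
Hypotheses (al_gt0 : 0 < al) (al_le : 2 * al <= 1) (q_range : 1 <= q < 2) (c_gt0 : 0 < c).
Local Notation Phi := (powsum c al (q / 2)).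

Let q0 : 0 < q.
Proof. by have [q1 _] := andP q_range; exact: lt_le_trans q1. Qed.

Let al2_ge0 : 0 <= 2 * al.
Proof. by rewrite mulr_ge0 // ltW. Qed.

Let al2_leq : 2 * al <= q.
Proof. by have [q1 _] := andP q_range; exact: le_trans q1. Qed.

Lemma powsum_sqr s : 0 <= s -> Phi (s ^+ 2) = c * (s `^ (2 * al) + s `^ q).
Proof. by move=> s0; rewrite /powsum !powR_sqr // (mulrC 2 (q / 2)) divfK. Qed.

Lemma powsum_nondecreasing a b : 0 <= a -> a <= b -> Phi a <= Phi b.
Proof.
move=> a0 ab; rewrite /powsum ler_wpM2l ?(ltW c_gt0) // lerD // ler_powRl // ?(ltW al_gt0) //.
by rewrite divr_ge0 // ltW.
Qed.

(** Separates the powers of [t]: for the exponent [2 * al <= 1] an upper bound on [t] is needed, for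
    [q >= 1] the bound [1 <= t] suffices. *)
Lemma mulr_powR_div (a t z : R) : 0 < t -> 0 <= z -> t * (z / t) `^ a = t `^ (1 - a) * z `^ a.
Proof.
move=> t0 z0; rewrite powRB; last by apply/implyP => _; rewrite gt_eqF.
rewrite powRr1 ?(ltW t0) // powRM // ?invr_ge0 ?(ltW t0) //.
by rewrite -[t^-1]powR_inv1 ?(ltW t0) // powRAC powR_inv1 ?powR_ge0 //; ring.
Qed.

Section small_noise.
Variable delta : R.
Hypothesis delta01 : 0 < delta <= 1.
Local Notation L := (delta `^ (2 * al - 1)).

Lemma dual_scale_ge1 : 1 <= L.
Proof.
have [d0 d1] := andP delta01.
by rewrite -{1}(powRr0 delta) ger_powR // subr_le0.
Qed.

Lemma dual_scale_mul : L * delta = delta `^ (2 * al).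
Proof. by have [d0 d1] := andP delta01; rewrite mulrC mulr_powRB1 // ?(ltW d0) // mulr_gt0. Qed.

Lemma powsum_scaled_le y : 1 <= y -> Phi ((delta * y) ^+ 2) <= 2 * c * y ^+ 2 * delta `^ (2 * al).
Proof.
move=> y1; have [d0 d1] := andP delta01; have y0 : 0 <= y := le_trans ler01 y1.
rewrite powsum_sqr ?mulr_ge0 ?(ltW d0) // !powRM ?(ltW d0) //.
have h1 : y `^ (2 * al) <= y ^+ 2 by rewrite -powR_mulrn // ler_powR // (le_trans al_le) // ler1n.
have h2 : y `^ q <= y ^+ 2 by rewrite -powR_mulrn // ler_powR //; case/andP: q_range => _ /ltW.
have h3 : delta `^ q <= delta `^ (2 * al) by rewrite ger_powR.
rewrite [leRHS](_ : _ = c * (delta `^ (2 * al) * y ^+ 2 + delta `^ (2 * al) * y ^+ 2)); last by ring.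
rewrite ler_wpM2l ?(ltW c_gt0) //.
by apply: lerD; apply: ler_pM; rewrite ?powR_ge0.
Qed.

Lemma error_rate (C C1 C2 P r e : R) : 0 < C -> 0 < C1 -> 0 < C2 -> 0 <= e ->
  0 <= P -> 0 <= r -> P <= C1 * L -> r <= C2 * delta ->
  C * e `^ q <= P * (r + delta) + Phi ((r + delta) ^+ 2) ->
  e <= ((C1 * (C2 + 1) + 2 * c * (C2 + 1) ^+ 2) / C) `^ q^-1 * delta `^ (2 * al / q).
Proof.
move=> C0 C10 C20 e0 P0 r0 hP hr h; have [d0 d1] := andP delta01.
set M := C1 * (C2 + 1) + _.
have hr2 : r + delta <= delta * (C2 + 1) by rewrite mulrDr mulr1 mulrC; lra.
have rd0 : 0 <= r + delta by rewrite addr_ge0 // ltW.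
have M0 : 0 <= M by rewrite addr_ge0 // !mulr_ge0 ?sqr_ge0 ?addr_ge0 // ltW.
have hM : C * e `^ q <= M * delta `^ (2 * al).
  apply: le_trans h _; rewrite /M mulrDl lerD //.
    apply: (@le_trans _ _ ((C1 * L) * (delta * (C2 + 1)))); first exact: ler_pM.
    by rewrite -dual_scale_mul le_eqVlt; apply/orP; left; apply/eqP; ring.
  apply: (@le_trans _ _ (Phi ((delta * (C2 + 1)) ^+ 2))).
    by apply: powsum_nondecreasing; rewrite ?sqr_ge0 // lerXn2r // nnegrE // (le_trans rd0).
  by apply: powsum_scaled_le; rewrite lerDr ltW.
have -> : e = (e `^ q) `^ q^-1 by rewrite -powRrM mulfV ?gt_eqF // powRr1.
rewrite powRrM -powRM ?divr_ge0 ?powR_ge0 // ?(ltW C0) //.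
apply: ler_powRl; rewrite ?invr_ge0 ?(ltW q0) ?powR_ge0 //.
by rewrite mulrAC ler_pdivlMr // mulrC.
Qed.

End small_noise.

(* In terms of the method: t = t_n, r = |r_n|, P = |p_n| and b = |p_0|. *)
Definition energy_bound (t r P b delta : R) :=
  t ^+ 2 * r ^+ 2 + P ^+ 2 <=
    b ^+ 2 + 2 * (t * delta * P) + 2 * (t * Phi (((P + b) / t + delta) ^+ 2)).

(** With P = L x and y = x + B + D the energy bound turns into y^2 <= C2 y^q, and [q < 2] yields y
    <= C2^(1 / (2 - q)), the constant [Y]. *)
Lemma energy_rate (B D : R) : 1 <= B -> 1 <= D -> exists2 M : R, 0 < M &
  forall delta t r P b : R, 0 < delta <= 1 -> 1 <= t ->
    t <= D * (delta `^ (2 * al - 1) / delta) -> 0 <= P -> 0 <= b -> b <= B ->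
    energy_bound t r P b delta ->
    t ^+ 2 * r ^+ 2 + P ^+ 2 <= M * (delta `^ (2 * al - 1)) ^+ 2.
Proof.
move=> B1 D1; have [q1 q2] := andP q_range.
pose C1 := B ^+ 2 + 2 * D + 2 * c * (D + 1).
pose C2 := 2 * C1 + 2 * (B + D) ^+ 2.
have C10 : 0 < C1.
  have : 0 <= c * (D + 1) by rewrite mulr_ge0 ?(ltW c_gt0) //; lra.
  have := sqr_ge0 B; rewrite /C1; lra.
pose Y := C2 `^ (2 - q)^-1.
have C20 : 0 < C2 by have := sqr_ge0 (B + D); rewrite /C2; lra.
exists (C1 * Y `^ q); first by rewrite mulr_gt0 // powR_gt0 // powR_gt0.
move=> delta t r P b d01 t1 tD P0 b0 bB hE; have [d0 d1] := andP d01.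
set L := delta `^ _ in tD *.
have L1 : 1 <= L := dual_scale_ge1 d01.
have L0 : 0 < L := lt_le_trans ltr01 L1.
have t0 : 0 < t := lt_le_trans ltr01 t1.
have [x x0 PE] : exists2 x, 0 <= x & P = L * x.
  by exists (P / L); rewrite ?divr_ge0 ?(ltW L0) // mulrC divfK // gt_eqF.
pose y := x + B + D.
have y1 : 1 <= y by rewrite /y; lra.
have y0 : 0 <= y := le_trans ler01 y1.
have td : t * delta <= D * L by rewrite -ler_pdivlMr // -mulrA.
set z := P + b + t * delta.
have z0 : 0 <= z by rewrite !addr_ge0 // mulr_ge0 // ltW.
have zL : z <= L * y.
  have : B <= L * B by rewrite ler_peMl //; lra.
  rewrite /z /y PE !mulrDr (mulrC L D); lra.
have zE : (P + b) / t + delta = z / t.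
  by rewrite /z (mulrDl (P + b)) (mulrC t) mulfK // gt_eqF.
have yq1 : y <= y `^ q by exact: le1r_powR.
(* Both powers scale like L^2. For the first, (L / delta)^(1 - 2 al) L^(2 al) = L^2 by L delta =
   delta^(2 al); for the second, t^(1 - q) <= 1 and L^q <= L^2. *)
have hPhi : t * Phi (((P + b) / t + delta) ^+ 2) <= c * (D + 1) * (L ^+ 2 * y `^ q).
  rewrite zE powsum_sqr ?divr_ge0 ?(ltW t0) // mulrCA -mulrA ler_wpM2l ?(ltW c_gt0) //.
  rewrite mulrDr !mulr_powR_div // (mulrDl D 1) mul1r; apply: lerD.
    apply: (@le_trans _ _ ((D * (L / delta)) `^ (1 - 2 * al) * (L * y) `^ (2 * al))).
      by rewrite ler_pM ?powR_ge0 // ler_powRl // ?(ltW t0) // subr_ge0.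
    have LdM : 0 < L / delta by rewrite divr_gt0.
    have D0 : 0 <= D := le_trans ler01 D1.
    rewrite (powRM _ D0 (ltW LdM)) (powRM _ (ltW L0) y0).
    have -> : L `^ (2 * al) = (L / delta) `^ (2 * al) * delta `^ (2 * al).
      by rewrite -powRM ?(ltW LdM) ?(ltW d0) // divfK // gt_eqF.
    have eL : (L / delta) `^ (1 - 2 * al) * (L / delta) `^ (2 * al) = L / delta.
      rewrite -powRD; first by rewrite subrK powRr1 // ltW.
      by rewrite subrK oner_eq0.
    rewrite -(dual_scale_mul d01) -/L.
    rewrite [leLHS](_ : _ = D `^ (1 - 2 * al) * ((L / delta) `^ (1 - 2 * al) * (L / delta) `^ (2 * al))
       * (L * delta) * y `^ (2 * al)); last by ring.
    rewrite eL [leLHS](_ : _ = D `^ (1 - 2 * al) * (L ^+ 2 * y `^ (2 * al))); last first.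
      by field; rewrite gt_eqF.
    apply: ler_pM; rewrite ?powR_ge0 ?mulr_ge0 ?sqr_ge0 ?powR_ge0 //.
      by apply: ler1_powR => //; rewrite gerBl.
    by rewrite ler_wpM2l ?sqr_ge0 // ler_powR.
  apply: (@le_trans _ _ (1 * (L * y) `^ q)).
    apply: ler_pM; rewrite ?powR_ge0 //; last by apply: ler_powRl => //; exact: ltW.
    by rewrite -[leRHS](powRr0 t) ler_powR // subr_le0.
  rewrite mul1r powRM ?(ltW L0) // ler_wpM2r ?powR_ge0 //.
  by rewrite -powR_mulrn ?(ltW L0) // ler_powR // ltW.
have yq0 : 1 <= y `^ q := le_trans y1 yq1.
have main : t ^+ 2 * r ^+ 2 + P ^+ 2 <= C1 * y `^ q * L ^+ 2.
  apply: le_trans hE _.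
  have h1 : b ^+ 2 <= B ^+ 2 * y `^ q * L ^+ 2.
    apply: (@le_trans _ _ (B ^+ 2)); first by rewrite lerXn2r ?nnegrE // (le_trans b0).
    have yL : 1 <= y `^ q * L ^+ 2 by apply: mulr_ege1 => //; exact: exprn_ege1.
    by rewrite -mulrA ler_peMr ?sqr_ge0.
  have h2 : t * delta * P <= D * y `^ q * L ^+ 2.
    apply: (@le_trans _ _ (D * L * (L * y `^ q))); last first.
      by rewrite le_eqVlt; apply/orP; left; apply/eqP; ring.
    apply: ler_pM => //; first by rewrite mulr_ge0 // ltW.
    rewrite PE ler_wpM2l ?(ltW L0) //; apply: le_trans yq1; rewrite /y; lra.
  rewrite [leRHS](_ : _ = B ^+ 2 * y `^ q * L ^+ 2 + 2 * (D * y `^ q * L ^+ 2) +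
     2 * (c * (D + 1) * (L ^+ 2 * y `^ q))); last by rewrite /C1; ring.
  by rewrite !lerD // ler_wpM2l.
apply: (le_trans main); rewrite ler_wpM2r ?sqr_ge0 // ler_wpM2l ?(ltW C10) //.
apply: ler_powRl => //; first exact: ltW.
have xC : x ^+ 2 <= C1 * y `^ q.
  have : P ^+ 2 <= C1 * y `^ q * L ^+ 2.
    by apply: le_trans main; rewrite lerDr mulr_ge0 // sqr_ge0.
  by rewrite PE exprMn mulrC ler_pM2r // exprn_gt0.
have yC : y ^+ 2 <= C2 * y `^ q.
  apply: (@le_trans _ _ (2 * x ^+ 2 + 2 * (B + D) ^+ 2)).
    by rewrite /y; have := sqr_ge0 (x - (B + D)); lra.
  rewrite /C2 (mulrDl (2 * C1)); apply: lerD; first by rewrite -mulrA ler_wpM2l.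
  by rewrite ler_peMr // mulr_ge0 // sqr_ge0.
have y00 : 0 < y := lt_le_trans ltr01 y1.
have : y `^ (2 - q) <= C2.
  rewrite powRB; last by apply/implyP => _; rewrite gt_eqF.
  by rewrite powR_mulrn // ler_pdivrMr // powR_gt0.
move=> h; have -> : y = (y `^ (2 - q)) `^ (2 - q)^-1.
  by rewrite -powRrM mulfV ?powRr1 // gt_eqF // subr_gt0.
by apply: ler_powRl; rewrite ?powR_ge0 // invr_ge0 subr_ge0 ltW.
Qed.

(** [rho] is any number above 1, so no constant may be lost in the leading term. With P = t delta x
    one has 2 x - x^2 = 1 - (x - 1)^2, and the negative square absorbs the growth of [Phi] in
    [x]. *)
Lemma discrepancy_reached (B rho : R) : 1 <= B -> 1 < rho -> exists2 D : R, 1 <= D &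
  forall delta t r P b : R, 0 < delta <= 1 ->
    D * (delta `^ (2 * al - 1) / delta) <= t -> 0 <= r -> 0 <= P -> 0 <= b -> b <= B ->
    energy_bound t r P b delta -> r <= rho * delta.
Proof.
move=> B1 rho1.
have rho2 : 0 < rho ^+ 2 - 1 by rewrite subr_gt0 expr_gt1 // (le_trans ler01) // ltW.
pose S := B ^+ 2 + 8 * c * (B + 2) ^+ 2.
have c8 : 0 <= 8 * c by rewrite mulr_ge0 // ltW.
have S0 : 0 <= S by rewrite /S addr_ge0 ?sqr_ge0 // mulr_ge0 // sqr_ge0.
(* [8 * c] makes D (x - 1)^2 absorb the contribution of [Phi], 1 ensures [1 <= D], and the quotient
   makes the remaining constant [S] at most (rho^2 - 1) D. *)
pose D := 8 * c + 1 + S / (rho ^+ 2 - 1).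
have Sr : 0 <= S / (rho ^+ 2 - 1) by rewrite divr_ge0 // ltW.
have D1 : 1 <= D by have := c_gt0; rewrite /D; lra.
have D0 : 0 < D := lt_le_trans ltr01 D1.
have Dc : 8 * c <= D by rewrite /D; lra.
have DS : S <= (rho ^+ 2 - 1) * D.
  rewrite mulrC -ler_pdivrMr // /D; have := c_gt0; lra.
clearbody D; exists D => // delta t r P b d01 tD r0 P0 b0 bB hE; have [d0 d1] := andP d01.
set L := delta `^ _ in tD.
have L1 : 1 <= L := dual_scale_ge1 d01.
have L0 : 0 < L := lt_le_trans ltr01 L1.
have t0 : 0 < t by apply: lt_le_trans tD; rewrite mulr_gt0 // divr_gt0.
have td : D * L <= t * delta by rewrite -ler_pdivrMr // -mulrA.
have td0 : 0 < t * delta by rewrite mulr_gt0.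
have tdD : D <= t * delta by apply: le_trans td; rewrite ler_peMr // ltW.
have [x x0 PE] : exists2 x, 0 <= x & P = t * delta * x.
  by exists (P / (t * delta)); rewrite ?divr_ge0 ?(ltW td0) // mulrC divfK // gt_eqF.
pose y := x + B + 1.
have y1 : 1 <= y by rewrite /y; lra.
have y0 : 0 <= y := le_trans ler01 y1.
have hs : (P + b) / t + delta <= delta * y.
  rewrite -lerBrDr ler_pdivrMr // /y PE.
  have : b <= t * delta * B by apply: le_trans bB _; rewrite ler_peMl ?(le_trans D1) //; lra.
  lra.
have s0 : 0 <= (P + b) / t + delta by rewrite addr_ge0 ?(ltW d0) // divr_ge0 ?(ltW t0) // addr_ge0.
have hPhi : Phi (((P + b) / t + delta) ^+ 2) <= 2 * c * y ^+ 2 * (L * delta).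
  rewrite (dual_scale_mul d01); apply: le_trans (powsum_scaled_le d01 y1).
  by apply: powsum_nondecreasing; rewrite ?sqr_ge0 // lerXn2r // nnegrE // (le_trans s0).
have hPhi2 : D * (t * Phi (((P + b) / t + delta) ^+ 2)) <= 2 * c * y ^+ 2 * (t * delta) ^+ 2.
  apply: (@le_trans _ _ (D * (t * (2 * c * y ^+ 2 * (L * delta))))).
    by rewrite ler_wpM2l ?(ltW D0) // ler_wpM2l // ltW.
  rewrite [leLHS](_ : _ = 2 * c * y ^+ 2 * (t * delta * (D * L))); last by ring.
  have cy : 0 <= 2 * c * y ^+ 2 by rewrite mulr_ge0 ?sqr_ge0 // mulr_ge0 // ltW.
  by rewrite ler_wpM2l // expr2 ler_wpM2l // ltW.
have hb : D * b ^+ 2 <= B ^+ 2 * (t * delta) ^+ 2.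
  rewrite mulrC; apply: ler_pM; rewrite ?sqr_ge0 ?(ltW D0) //.
    by rewrite lerXn2r ?nnegrE // (le_trans b0).
  apply: (le_trans tdD); rewrite expr2 ler_peMr ?(ltW td0) //; exact: le_trans tdD.
have : D * (t ^+ 2 * r ^+ 2) <= D * rho ^+ 2 * (t * delta) ^+ 2.
  have h := ler_wpM2l (ltW D0) hE.
  (* [y] is split as (x - 1) + (B + 2), centred at the point where 2 x - x^2 is maximal. *)
  have hy : y ^+ 2 <= 2 * (x - 1) ^+ 2 + 2 * (B + 2) ^+ 2.
    by rewrite /y; have := sqr_ge0 (x - 1 - (B + 2)); lra.
  have T0 : 0 <= (t * delta) ^+ 2 := sqr_ge0 _.
  apply: (@le_trans _ _ (B ^+ 2 * (t * delta) ^+ 2 + 2 * D * x * (t * delta) ^+ 2 +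
    2 * (2 * c * y ^+ 2 * (t * delta) ^+ 2) - D * x ^+ 2 * (t * delta) ^+ 2)).
    move: h; rewrite mulrDr PE => h.
    rewrite -lerBlDr opprK [_ * x ^+ 2 * _](_ : _ = D * (t * delta * x) ^+ 2); last by ring.
    apply: le_trans h _; rewrite !mulrDr !lerD //.
      by rewrite le_eqVlt; apply/orP; left; apply/eqP; ring.
    by rewrite mulrCA ler_wpM2l //; move: hPhi2; rewrite PE.
  rewrite [leLHS](_ : _ = (B ^+ 2 + 2 * D * x + 4 * c * y ^+ 2 - D * x ^+ 2) * (t * delta) ^+ 2); last by ring.
  apply: ler_wpM2r => //.
  have : 4 * c * y ^+ 2 <= 4 * c * (2 * (x - 1) ^+ 2 + 2 * (B + 2) ^+ 2).
    by rewrite ler_wpM2l // mulr_ge0 // ltW.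
  have : 8 * c * (x - 1) ^+ 2 <= D * (x - 1) ^+ 2 by rewrite ler_wpM2r // sqr_ge0.
  move: DS; rewrite /S; lra.
have -> : D * rho ^+ 2 * (t * delta) ^+ 2 = D * t ^+ 2 * (rho * delta) ^+ 2 by ring.
rewrite mulrA ler_pM2l ?mulr_gt0 ?exprn_gt0 // ler_pXn2r // nnegrE.
by rewrite mulr_ge0 ?(ltW d0) // (le_trans ler01) // ltW.
Qed.

End rates.

Unset Implicit Arguments.

Theorem mainTheorem3 (R : realType) (X H : completeNormedModType R)
    (dotX : {dot X for idfun}) (dotH : {dot H for idfun})
    (hilbertX : norm_of_dot dotX) (hilbertH : norm_of_dot dotH)
    (phi : nat -> X) (phi_basis : orthonormal_basis dotX phi)
    (K : {linear X -> H}) (K_bounded : continuous K)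
    (q : R) (q_range : 1 <= q < 2)
    (J : X -> \bar R) (J_def : J = lq_penalty dotX phi q)
    (g : H) (udag : X) (udag_sol : constrained_solution K J g udag)
    (nu : R) (nu_range : 0 < nu <= 1 / 2) (pdag xidag : X)
    (source : op_powR (fun x => adjoint dotX dotH K (K x)) nu pdag = xidag)
    (xidag_sub : subdifferential dotX J udag xidag)
    (supp_finite : finite_set (supp dotX phi udag))
    (inj_q_gt1 : 1 < q -> set_inj (lspan phi (supp dotX phi udag)) K)
    (inj_q_eq1 : q = 1 ->
       set_inj (lspan phi [set i | `|dotX (phi i) xidag| = 1]) K) :
  (exists (C : R) (Phi : R -> R),
     [/\ 0 < C,
         index_function Phi,
         asymp0 (fun s => (Phi s)%:E)
                (fun s => s `^ (q * nu / (q - 1 + 2 * nu))),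
         (forall u : X, ((C * `|udag - u| `^ q)%:E
            <= J u - J udag + (Phi (`|K u - g| ^+ 2))%:E)%E)
       & asymp0 (conjugate_inv Phi)
           (fun s => s `^ ((q - 1 + 2 * nu) / (q - 1 + (2 - q) * nu)))])
  /\
  (forall (B : R) (tau : nat -> R) (n : R -> nat),
     step_sizes tau ->
     asymp0 (fun delta => (stepsum tau (n delta))%:E)
            (fun delta => delta `^ (- (2 * ((q - 1 + (2 - q) * nu)
                                            / (q - 1 + 2 * nu))))) ->
     exists C : R, 0 < C /\
       \forall delta \near 0^'+,
         forall (gd p0 : H) (u : nat -> X) (p : nat -> H),
           `|g - gd| <= delta -> `|p0| <= B ->
           alm_iterates dotH K J tau gd p0 u p ->
           `|u (n delta) - udag| <= C * delta `^ (2 * nu / (q - 1 + 2 * nu)))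
  /\
  (forall (B rho T : R), 1 < rho ->
     exists C : R, 0 < C /\
       forall tau : nat -> R,
         step_sizes tau -> (forall k, (1 <= k)%N -> tau k <= T) ->
         \forall delta \near 0^'+,
           forall (gd p0 : H) (u : nat -> X) (p : nat -> H),
             `|g - gd| <= delta -> `|p0| <= B ->
             alm_iterates dotH K J tau gd p0 u p ->
             exists nstar : nat,
               discrepancy_index K rho delta gd u nstar /\
               `|u nstar - udag| <= C * delta `^ (2 * nu / (q - 1 + 2 * nu))).
Proof.
have [q1 q2] := andP q_range; have [nu0 nu1] := andP nu_range.
have q0 : 0 < q := lt_le_trans ltr01 q1.
have m0 : 0 < q - 1 + 2 * nu by rewrite ltr_wpDl ?subr_ge0 // mulr_gt0.
have k0 : 0 < q - 1 + (2 - q) * nu by rewrite ltr_wpDl ?subr_ge0 // mulr_gt0 // subr_gt0.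
set al := q * nu / (q - 1 + 2 * nu).
have al0 : 0 < al by rewrite divr_gt0 // mulr_gt0.
have al1 : 2 * al <= 1 by rewrite /al mulrA ler_pdivrMr // mul1r; nra.
have alq : al <= q / 2.
  rewrite /al -mulrA ler_wpM2l ?(ltW q0) // ler_pdivrMr //; lra.
have q21 : 0 < q / 2 < 1 by rewrite divr_gt0 //= ltr_pdivrMr // mul1r.
have [Kdag Jdag_fin _] := udag_sol.
rewrite J_def in Jdag_fin xidag_sub *.
have J0 := lq_penalty_ge0 dotX phi q.
have [y0 Jdag] : exists y0, lq_penalty dotX phi q udag = y0%:E.
  have := J0 udag; case: (lq_penalty _ _ _ _) Jdag_fin => [y| |] // _ _; by exists y.
have y00 : 0 <= y0 by rewrite -lee_fin -Jdag.
have [C [c [C0 c0 vi]]] := variational_inequality hilbertX hilbertH phi_basis K_bounded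
  q_range Kdag nu_range source xidag_sub supp_finite inj_q_gt1 inj_q_eq1.
rewrite -/al in vi.
have iPhi : index_function (powsum c al (q / 2)).
  by apply: powsum_index_function => //; lra.
have Phi_mono a b := @powsum_nondecreasing R al q c al0 q_range c0 a b.
have Jconv t u v := @lq_penalty_convex R X dotX phi q q_range t u v.
have vi' v y : lq_penalty dotX phi q v = y%:E ->
    C * `|udag - v| `^ q <= y - y0 + powsum c al (q / 2) (`|K v - g| ^+ 2).
  by move=> Jv; exact: vi Jv Jdag.
have expE : 2 * nu / (q - 1 + 2 * nu) = 2 * al / q.
  by rewrite /al; field; rewrite !gt_eqF.
have energy B tau delta gd p0 u p n : step_sizes tau -> `|g - gd| <= delta ->
    `|p0| <= B -> alm_iterates dotH K (lq_penalty dotX phi q) tau gd p0 u p ->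
    energy_bound al q c (stepsum tau n.+1) `|K (u n.+1) - gd| `|p n.+1| `|p0| delta.
  move=> [tau0 _] gdelta p0B alm.
  exact: (alm_energy_variational hilbertH J0 Jconv Jdag Kdag tau0 alm gdelta Phi_mono (ltW C0) vi').
have error tau delta gd p0 u p n (C1 C2 : R) : step_sizes tau -> `|g - gd| <= delta ->
    alm_iterates dotH K (lq_penalty dotX phi q) tau gd p0 u p ->
    0 < delta <= 1 -> 0 < C1 -> 0 < C2 -> `|p n.+1| <= C1 * delta `^ (2 * al - 1) ->
    `|K (u n.+1) - gd| <= C2 * delta ->
    `|u n.+1 - udag| <= ((C1 * (C2 + 1) + 2 * c * (C2 + 1) ^+ 2) / C) `^ q^-1 * delta `^ (2 * al / q).
  move=> [tau0 _] gdelta alm d01 C10 C20 hP hr.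
  apply: (error_rate al0 al1 q_range c0 d01 C0 C10 C20 _ _ _ hP hr) => //.
  exact: (alm_error hilbertH J0 Jconv Jdag Kdag tau0 alm gdelta Phi_mono vi').
have const_gt0 (C1 C2 : R) : 0 < C1 -> 0 < C2 ->
    0 < ((C1 * (C2 + 1) + 2 * c * (C2 + 1) ^+ 2) / C) `^ q^-1.
  move=> C10 C20; have C21 : 0 < C2 + 1 by rewrite addr_gt0.
  by rewrite powR_gt0 // divr_gt0 // addr_gt0 ?mulr_gt0 // exprn_gt0.
(* [M + 1] replaces the square root of [M]. *)
have sqr_bound (M a L : R) : 0 < M -> 0 <= a -> 0 <= L -> a ^+ 2 <= M * L ^+ 2 -> a <= (M + 1) * L.
  move=> M0 a0 L0 h; rewrite -(@ler_pXn2r _ 2) ?nnegrE ?mulr_ge0 ?addr_ge0 // ?(ltW M0) //.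
  apply: (le_trans h); rewrite exprMn ler_wpM2r ?sqr_ge0 //.
  rewrite expr2; nra.
rewrite expE; split; [|split].
- exists C, (powsum c al (q / 2)); split => //.
  + exact: powsum_asymp.
  + move=> u; rewrite Jdag; case Ju : (lq_penalty dotX phi q u) => [y| |].
    * by rewrite -EFinN -!EFinD lee_fin; exact: vi'.
    * by rewrite addye // leey.
    * by have := J0 u; rewrite Ju.
  + have -> : (q - 1 + 2 * nu) / (q - 1 + (2 - q) * nu) = (1 - al)^-1.
      have -> : 1 - al = (q - 1 + (2 - q) * nu) / (q - 1 + 2 * nu).
        by rewrite /al; field; rewrite gt_eqF.
      by rewrite invf_div.
    by apply: conjugate_inv_powsum => //; case/andP: q21.
- move=> B tau n tauP [c1 [c2 [c10 c20 tn]]].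
  (* [B] is arbitrary, whereas the rate lemmas ask for a bound that is at least 1. *)
  have B1 : 1 <= `|B| + 1 by rewrite lerDr.
  have D1 : 1 <= c2 + 1 by rewrite lerDr ltW.
  have [M M0 rate] := energy_rate al0 al1 q_range c0 B1 D1.
  have M1 : 0 < M + 1 by rewrite addr_gt0.
  (* [M + 1] bounds |p_n| / L; dividing t_n |r_n| <= (M + 1) L by t_n >= c1 L / delta gives the
     residual constant (M + 1) / c1. *)
  exists ((((M + 1) * ((M + 1) / c1 + 1) + 2 * c * ((M + 1) / c1 + 1) ^+ 2) / C) `^ q^-1).
  split; first by apply: const_gt0 => //; exact: divr_gt0.
  near=> delta => gd p0 u p gdelta p0B alm.
  have d0 : 0 < delta by near: delta; exact: nbhs_right_gt.
  have d1 : delta <= 1 by near: delta; exact: nbhs_right_le.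
  (* Guarantees t_n >= 1, since t_n >= c1 L / delta and L >= 1. *)
  have dc1 : delta <= c1 by near: delta; exact: nbhs_right_le.
  have d01 : 0 < delta <= 1 by rewrite d0.
  have : ((c1 * delta `^ (- (2 * ((q - 1 + (2 - q) * nu) / (q - 1 + 2 * nu)))))%:E <=
    (stepsum tau (n delta))%:E <=
    (c2 * delta `^ (- (2 * ((q - 1 + (2 - q) * nu) / (q - 1 + 2 * nu)))))%:E)%E by near: delta.
  have -> : delta `^ (- (2 * ((q - 1 + (2 - q) * nu) / (q - 1 + 2 * nu)))) =
      delta `^ (2 * al - 1) / delta.
    have -> : - (2 * ((q - 1 + (2 - q) * nu) / (q - 1 + 2 * nu))) = (2 * al - 1) - 1.
      by rewrite /al; field; rewrite gt_eqF.
    rewrite powRB; last by apply/implyP => _; rewrite gt_eqF.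
    by rewrite powRr1 // ltW.
  set L := delta `^ (2 * al - 1); rewrite !lee_fin => /andP[t1 t2].
  have L1 : 1 <= L := dual_scale_ge1 al1 d01.
  have L0 : 0 < L := lt_le_trans ltr01 L1.
  have Ld0 : 0 < L / delta by rewrite divr_gt0.
  case: (n delta) t1 t2 => [|m] t1 t2.
    by move: t1; rewrite stepsum0 leNgt mulr_gt0.
  have t_ge1 : 1 <= stepsum tau m.+1.
    apply: le_trans t1; rewrite mulrA ler_pdivlMr // mul1r.
    by apply: (le_trans dc1); rewrite ler_peMr // ltW.
  have t_gt0 : 0 < stepsum tau m.+1 := lt_le_trans ltr01 t_ge1.
  have t_le : stepsum tau m.+1 <= (c2 + 1) * (L / delta).
    by apply: (le_trans t2); rewrite ler_wpM2r ?(ltW Ld0) // lerDl.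
  have p0B' : `|p0| <= `|B| + 1.
    by apply: (le_trans p0B); apply: (le_trans (ler_norm _)); rewrite lerDl.
  have h := rate _ _ _ _ _ d01 t_ge1 t_le (normr_ge0 _) (normr_ge0 _) p0B'
    (energy _ _ _ _ _ _ _ m tauP gdelta p0B alm).
  apply: (error _ _ _ _ _ _ _ _ _ tauP gdelta alm d01) => //; first exact: divr_gt0.
    apply: sqr_bound => //; first exact: ltW.
    by apply: le_trans h; rewrite lerDr mulr_ge0 ?sqr_ge0.
  have : stepsum tau m.+1 * `|K (u m.+1) - gd| <= (M + 1) * L.
    apply: sqr_bound => //; [by rewrite mulr_ge0 // ltW|exact: ltW|].
    by rewrite exprMn; apply: le_trans h; rewrite lerDl sqr_ge0.
  move=> /(le_trans (ler_wpM2r (normr_ge0 _) t1)) h2.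
  have h3 : c1 * `|K (u m.+1) - gd| * L <= (M + 1) * delta * L.
    rewrite [leLHS](_ : _ = c1 * (L / delta) * `|K (u m.+1) - gd| * delta); last first.
      by field; rewrite gt_eqF.
    by rewrite [leRHS]mulrAC ler_wpM2r // ltW.
  by move: h3; rewrite ler_pM2r // mulrAC ler_pdivlMr // mulrC.
- move=> B rho T rho1.
  have B1 : 1 <= `|B| + 1 by rewrite lerDr.
  have [D D1 reached] := discrepancy_reached al0 al1 q_range c0 B1 rho1.
  have D0 : 0 < D := lt_le_trans ltr01 D1.
  have D1' : 1 <= D + `|T| by rewrite (le_trans D1) // lerDl.
  have [M M0 rate] := energy_rate al0 al1 q_range c0 B1 D1'.
  have rho0 : 0 < rho := lt_trans ltr01 rho1.
  (* Sum of two bounds for the dual iterate, one for t_n >= 1 and one for t_n < 1, where stopping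
     may occur early. *)
  pose N := M + 1 + ((`|B| + 1) ^+ 2 + 2 * y0 + 2).
  have N0 : 0 < (`|B| + 1) ^+ 2 + 2 * y0 + 2.
    by rewrite ltr_wpDl // addr_ge0 ?sqr_ge0 // mulr_ge0.
  have NN0 : 0 < N by rewrite /N (addr_gt0 _ N0) // addr_gt0.
  exists (((N * (rho + 1) + 2 * c * (rho + 1) ^+ 2) / C) `^ q^-1).
  split; first exact: const_gt0.
  move=> tau tauP tauT; near=> delta => gd p0 u p gdelta p0B alm.
  have d0 : 0 < delta by near: delta; exact: nbhs_right_gt.
  have d1 : delta <= 1 by near: delta; exact: nbhs_right_le.
  have d01 : 0 < delta <= 1 by rewrite d0.
  set L := delta `^ (2 * al - 1).
  have L1 : 1 <= L := dual_scale_ge1 al1 d01.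
  have L0 : 0 < L := lt_le_trans ltr01 L1.
  have Ld1 : 1 <= L / delta by rewrite ler_pdivlMr // mul1r (le_trans d1).
  have Ld0 : 0 < L / delta := lt_le_trans ltr01 Ld1.
  have p0B' : `|p0| <= `|B| + 1.
    by apply: (le_trans p0B); apply: (le_trans (ler_norm _)); rewrite lerDl.
  have en m := energy _ _ _ _ _ _ _ m tauP gdelta p0B alm.
  have stop m : D * (L / delta) <= stepsum tau m.+1 -> `|K (u m.+1) - gd| <= rho * delta.
    move=> tm; exact: (reached _ _ _ _ _ d01 tm (normr_ge0 _) (normr_ge0 _) (normr_ge0 _) p0B' (en m)).
  have ex : exists m, (1 <= m)%N && (`|K (u m) - gd| <= rho * delta).
    have /cvgryPge /(_ (D * (L / delta))) [m _ hm] := tauP.2.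
    by exists m.+1; rewrite /= stop //; apply: hm; rewrite /= leqnSn.
  have [m /andP[m1 hm] mmin] := ex_minnP ex.
  exists m; split; first by split => // k k1 hk; apply: mmin; rewrite k1.
  case: m m1 hm mmin => // m _ hm mmin.
  apply: (error _ _ _ _ _ _ _ _ _ tauP gdelta alm d01) => //.
  have t_gt0 : 0 < stepsum tau m.+1 by apply: stepsum_gt0; exact: tauP.1.
  have t_le : stepsum tau m.+1 <= (D + `|T|) * (L / delta).
    (* One step before stopping the residual was still too large, so by [stop] the step sum was
       below the threshold; the last step adds at most [T]. If stopping occurs at index 1, the
       earlier sum is empty. *)
    have tm : stepsum tau m <= D * (L / delta).
      case: m hm mmin {t_gt0} => [_ _|m _ mmin]; first by rewrite stepsum0 mulr_ge0 // ltW.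
      rewrite leNgt; apply/negP => /ltW /stop h.
      by have := mmin m.+1; rewrite h ltnn => /(_ isT).
    rewrite stepsumS mulrDl lerD //.
    apply: (@le_trans _ _ `|T|); first by rewrite (le_trans (tauT _ _)) // ler_norm.
    by rewrite ler_peMr.
  have [t_ge1|t_lt1] := leP 1 (stepsum tau m.+1).
    have h := rate _ _ _ _ _ d01 t_ge1 t_le (normr_ge0 _) (normr_ge0 _) p0B' (en m).
    apply: (@le_trans _ _ ((M + 1) * L)).
      apply: sqr_bound => //; first exact: ltW.
      by apply: le_trans h; rewrite lerDr mulr_ge0 ?sqr_ge0.
    by rewrite ler_wpM2r ?(ltW L0) // /N lerDl ltW.
  apply: (@le_trans _ _ N); last by rewrite ler_peMr // ltW.
  have := alm_energy_crude hilbertH J0 Jconv Jdag Kdag tauP.1 alm gdelta m.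
  set P := `|p m.+1|; set t := stepsum tau m.+1 in t_gt0 t_lt1 *.
  have P0 : 0 <= P := normr_ge0 _.
  have h1 : `|p0| ^+ 2 <= (`|B| + 1) ^+ 2 by rewrite lerXn2r ?nnegrE // addr_ge0.
  have h2 : t * delta * P <= P.
    by rewrite ler_piMl // mulr_ile1 ?(ltW t_gt0) ?(ltW d0) // ltW.
  have h3 : t * y0 <= y0 by rewrite ler_piMl // ltW.
  have h4 : 0 <= t ^+ 2 * `|residual K gd u m.+1| ^+ 2 by rewrite mulr_ge0 ?sqr_ge0.
  move=> h5.
  have h6 : P ^+ 2 <= (`|B| + 1) ^+ 2 + 2 * y0 + 2 * P.
    move: h1 h2 h3 h4 h5; set b2 := (`|B| + 1) ^+ 2; set r2 := _ * `|residual _ _ _ _| ^+ 2.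
    set tP := t * delta * P; set ty := t * y0; lra.
  (* P^2 <= S + 2 P forces P <= S + 2: otherwise P > 1 and P^2 > (S + 2) P >= S + 2 P. *)
  suff h7 : P <= (`|B| + 1) ^+ 2 + 2 * y0 + 2 by apply: (le_trans h7); rewrite /N lerDr ltW // addr_gt0.
  rewrite leNgt; apply/negP => h8.
  have S0 : 0 <= (`|B| + 1) ^+ 2 + 2 * y0 by rewrite addr_ge0 ?sqr_ge0 // mulr_ge0.
  move: h6 h8 S0; set S := (_ + 1) ^+ 2 + _ => h6 h8 S0.
  have P1 : 1 < P by move: h8 S0; clearbody S P; lra.
  have h9 : (S + 2) * P < P ^+ 2 by rewrite expr2 ltr_pM2r // (lt_trans ltr01).
  have h10 : S <= S * P by rewrite ler_peMr // ltW.
  move: h6 h9; rewrite mulrDl; lra.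
Unshelve. all: by end_near. Qed.
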